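(* For every knot type $K$ in $\mathbb{R}^3$ and every finite $\Lambda\ge m_K$, the space $Y_\Lambda(K)$ is compact and Hausdorff.
   Context: Knot types are tame types of knots (one component) in Euclidean $\mathbb{R}^3$. For an embedded closed $C^{1,1}$ curve $\gamma$ ($C^1$ with Lipschitz unit tangent), $\operatorname{Len}(\gamma)$ is the length and the thickness $\operatorname{Thi}(\gamma)$ is the reach of its image, i.e. the supremum of $r>0$ for which the closed $r$-neighbourhood is an embedded solid torus that is the union of the closed normal discs of radius $r$; equivalently, $\operatorname{Thi}(\gamma)$ is the infimum of the radii of circles through three distinct points of $\gamma$. The minimal ropelength is $m_K=\inf\{\operatorname{Len}(\gamma)/\operatorname{Thi}(\gamma):[\gamma]=K\}$. Represent configurations by constant-speed $C^{1,1}$ embeddings $\gamma:S^1=\mathbb{R}/2\pi\mathbb{Z}\to\mathbb{R}^3$, and identify two of them when they differ by an orientation-preserving Euclidean isometry and a rotation or reflection of the source circle. For $m_K\le\Lambda<\infty$, $$Y_\Lambda(K)=\{[\gamma]:\gamma\text{ has knot type }K,\ \operatorname{Thi}(\gamma)\ge1,\ \operatorname{Len}(\gamma)\le\Lambda\},$$ topologised as a quotient of the constant-speed $C^1$ topology. *)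

(* Defs.v *)
From HB Require Import structures.
From mathcomp Require Import all_boot all_order all_algebra.
From mathcomp Require Import all_classical all_reals all_analysis.
Import Order.TTheory GRing.Theory Num.Theory.
Import numFieldNormedType.Exports.

Set Implicit Arguments.
Unset Strict Implicit.
Unset Printing Implicit Defensive.

Local Open Scope classical_set_scope.
Local Open Scope ring_scope.

(* Points of R^3 are row vectors.  The library norm `|x| on matrices is the
   sup norm: it induces the right topology, derivatives and Lipschitz maps, but
   lengths and distances below must use the Euclidean norm. *)
Notation "''E3[' R ]" := 'rV[R]_3 (at level 8, format "''E3[' R ]").

Section Ropes.
Variable R : realType.
Implicit Types (x y : 'E3[R]) (A k : set 'E3[R]) (g : R -> 'E3[R]).

Definition enorm x : R := Num.sqrt (\sum_i x 0 i ^+ 2).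

(* Maps out of the circle R/2piZ are functions on R compatible with
   [circle_eq]. *)
Definition circle_eq (s t : R) := exists n : int, t = s + 2 * pi * n%:~R.

(* Periodicity and injectivity on the circle, at once. *)
Definition circle_injection g := forall s t, g s = g t <-> circle_eq s t.

Definition knot k :=
  exists g, [/\ continuous g, circle_injection g & range g = k].

Definition segment x y : set 'E3[R] :=
  [set (1 - t) *: x + t *: y | t in `[0, 1]].

Definition polygonal_knot k :=
  knot k /\ exists s : seq ('E3[R] * 'E3[R]),
    k = \bigcup_(e in [set` s]) segment e.1 e.2.

Definition homeomorphism (f : 'E3[R] -> 'E3[R]) :=
  continuous f /\
  exists f', [/\ continuous f', cancel f f' & cancel f' f].

Definition ambient_isotopic k1 k2 :=
  exists H : R * 'E3[R] -> 'E3[R],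
    [/\ {within `[0, 1] `*` setT, continuous H},
        forall t : R, t \in `[0, 1] -> homeomorphism (fun x => H (t, x)),
        forall x, H (0, x) = x
      & (fun x => H (1, x)) @` k1 = k2].

Definition tame_knot k :=
  knot k /\ exists2 p, polygonal_knot p & ambient_isotopic k p.

Definition knot_type (K : set (set 'E3[R])) :=
  exists2 k, tame_knot k & K = [set k' | ambient_isotopic k k'].

Definition unit_tangent g (t : R) : 'E3[R] :=
  (enorm (derive1 g t))^-1 *: derive1 g t.

Definition C11_embedding g :=
  [/\ circle_injection g,
      forall t, derivable g t 1,
      continuous (derive1 g),
      forall t, derive1 g t != 0
    & [lipschitz unit_tangent g t | t in setT]].

Definition curve_length g : R :=
  \int[lebesgue_measure]_(t in `[0, 2 * pi]) enorm (derive1 g t).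

Definition set_dist x A : R := inf [set enorm (x - a) | a in A].

Definition nearest_point A x a :=
  A a /\ forall b, A b -> enorm (x - a) <= enorm (x - b).

(* Reach in the sense of Federer. *)
Definition reach A : \bar R :=
  ereal_sup [set r%:E | r in [set r : R | 0 <= r /\
    forall x, set_dist x A < r -> exists! a, nearest_point A x a]].

Definition thickness g : \bar R := reach (range g).

Definition min_ropelength (K : set (set 'E3[R])) : \bar R :=
  ereal_inf [set ((curve_length g)%:E / thickness g)%E | g in
    [set g | C11_embedding g /\ K (range g)]].

Definition constant_speed g := exists c, forall t, enorm (derive1 g t) = c.

Definition configuration (K : set (set 'E3[R])) (Lam : R) g :=
  [/\ C11_embedding g, constant_speed g, K (range g),
      (1 <= thickness g)%E & curve_length g <= Lam].

Definition proper_isometry (f : 'E3[R] -> 'E3[R]) :=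
  exists (A : 'M[R]_3) (b : 'E3[R]),
    [/\ A *m A^T = 1%:M, \det A = 1 & forall x, f x = x *m A + b].

(* Lift to R of a rotation (e = 1) or a reflection (e = -1) of R/2piZ. *)
Definition circle_isometry (h : R -> R) :=
  exists e a : R, (e = 1 \/ e = -1) /\ forall t, h t = e * t + a.

Definition same_shape g1 g2 :=
  exists (f : 'E3[R] -> 'E3[R]) (h : R -> R),
    [/\ proper_isometry f, circle_isometry h & g2 = f \o g1 \o h].

Lemma same_shape_refl g : same_shape g g.
Proof.
exists id, id; split => //.
  by exists 1%:M, 0; split; rewrite ?trmx1 ?mulmx1 ?det1// => x; rewrite mulmx1 addr0.
by exists 1, 0; split; [left|move=> t; rewrite mul1r addr0].
Qed.

Lemma same_shape_sym g1 g2 : same_shape g1 g2 -> same_shape g2 g1.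
Proof.
move=> [f [h [[A [b [AAT dA fE]]] [e [a [eE hE]]] ->]]].
have ee : e * e = 1 by case: eE => ->; rewrite ?mulrNN mulr1.
exists (fun x => x *m A^T - b *m A^T), (fun t => e * t - e * a); split.
- exists A^T, (- (b *m A^T)); split => //; last by rewrite det_tr.
  by rewrite trmxK; exact: mulmx1C.
- by exists e, (- (e * a)).
- apply/funext => t /=; rewrite fE hE.
  by rewrite mulmxDl addrK -mulmxA AAT mulmx1 mulrBr !mulrA ee !mul1r subrK.
Qed.

Lemma same_shape_trans g1 g2 g3 :
  same_shape g1 g2 -> same_shape g2 g3 -> same_shape g1 g3.
Proof.
move=> [f [h [[A [b [AAT dA fE]]] [e [a [eE hE]]] ->]]].
move=> [f' [h' [[A' [b' [AAT' dA' fE']]] [e' [a' [eE' hE']]] ->]]].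
exists (f' \o f), (h \o h'); split => //.
- exists (A *m A'), (b *m A' + b'); split; last 1 first.
  + by move=> x /=; rewrite fE' fE mulmxDl mulmxA addrA.
  + by rewrite trmx_mul mulmxA -(mulmxA A) AAT' mulmx1.
  + by rewrite det_mulmx dA dA' mulr1.
- exists (e * e'), (e * a' + a); split; last first.
    by move=> t /=; rewrite hE hE' mulrDr mulrA addrA.
  by case: eE => ->; case: eE' => ->; rewrite ?mulrNN ?mul1r ?mulr1; [left|right|right|left].
Qed.

End Ropes.

Section RopeSpace.
Local Open Scope quotient_scope.
Variables (R : realType) (K : set (set 'E3[R])) (Lam : R).

Definition config := set_type [set g | configuration K Lam g].

Definition C1_jet (c : config) : {uniform R -> 'E3[R]} * {uniform R -> 'E3[R]} :=
  (val c, derive1 (val c)).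

HB.instance Definition _ := Choice.on config.

(* The C^1 topology: uniform convergence of the curve and of its derivative. *)
HB.instance Definition _ := Topological.copy config (initial_topology C1_jet).

Definition config_rel (c d : config) : bool := `[< same_shape (val c) (val d) >].

Lemma config_rel_refl : reflexive config_rel.
Proof. by move=> c; apply/asboolP; exact: same_shape_refl. Qed.

Lemma config_rel_sym : symmetric config_rel.
Proof. by move=> c d; apply/asboolP/asboolP; exact: same_shape_sym. Qed.

Lemma config_rel_trans : transitive config_rel.
Proof.
move=> d c e /asboolP cd /asboolP de; apply/asboolP.
exact: same_shape_trans cd de.
Qed.

Canonical config_equiv :=
  EquivRel config_rel config_rel_refl config_rel_sym config_rel_trans.

Definition rope_space := quotient_topology {eq_quot config_equiv}.

HB.instance Definition _ := Quotient.on rope_space.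
HB.instance Definition _ := Topological.on rope_space.

End RopeSpace.

(* Main.v *)
(* A constant speed curve has thickness at least 1 exactly when it never enters
   a unit ball tangent to it, and this is an inequality between finitely many
   values of the curve and of its velocity, hence closed under pointwise limits.
   It also bounds the speed from below, the Lipschitz constant of the velocity
   from above and the chord-arc ratio, uniformly in terms of the length bound.
   So an ultrafilter of shapes, translated to start at the origin, has a
   pointwise limit; the limit is uniform in C^1, is again a thick embedded
   curve, and has the same knot type because a C^1-small displacement of a curve
   with controlled chord-arc ratio extends to a Lipschitz displacement of space
   with constant less than 1.  The space is Hausdorff because the orthogonal
   group and the circle are compact, so that inequivalent curves stay at
   positive distance modulo isometries and reparametrisations. *)

Require Import Defs.
From HB Require Import structures.
From mathcomp Require Import all_boot all_order all_algebra.
From mathcomp Require Import all_classical all_reals all_analysis.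
From mathcomp Require Import ring lra.
Import Order.TTheory GRing.Theory Num.Theory.
Import numFieldNormedType.Exports.

Set Implicit Arguments.
Unset Strict Implicit.
Unset Printing Implicit Defensive.

Local Open Scope classical_set_scope.
Local Open Scope ring_scope.

(** Thickness is defined by uniqueness of nearest points, a condition that limits of curves do not
    visibly inherit. The hard direction is from reach to tangent balls: Taylor's formula makes [g s]
    nearest to points slightly off the curve along a normal, but only up to a radius depending on
    the curve and on [s]; uniqueness must push that radius up to every value below 1. The other
    estimates follow from the tangent balls. The velocities at both ends of a short chord are
    compared with the chord itself, whence the Lipschitz constant 2c^2. A curve with c pi < 2 would
    have the point opposite [g s] both ahead of and behind [g s], whence c >= 2/pi; this is what
    makes the chord-arc constant 8 pi independent of the curve. Ultrafilters give limits at all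
    parameters at once, so no subsequence is extracted. The limit of the velocities is the velocity
    of the limit because a quadratic Taylor remainder is a closed condition. The threshold 1/(32 pi)
    for keeping the knot type is 8 pi from chord-arc, times 2 for Euclidean against sup norm, times
    2 to get a displacement of Lipschitz constant 1/2. *)

Section Euclid.
Variable R : realType.
Implicit Types u v w : 'E3[R].

(** * The Euclidean inner product and its comparison with the sup norm *)

Definition dot u v : R := \sum_i u 0 i * v 0 i.

Lemma dotE u v : dot u v = u 0 ord0 * v 0 ord0 +
  u 0 (lift ord0 ord0) * v 0 (lift ord0 ord0) +
  u 0 (lift ord0 (lift ord0 ord0)) * v 0 (lift ord0 (lift ord0 ord0)).
Proof. by rewrite /dot !big_ord_recl big_ord0 addr0 addrA. Qed.

Lemma dotC u v : dot u v = dot v u.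
Proof. by rewrite !dotE; ring. Qed.

Lemma dotDl u v w : dot (u + v) w = dot u w + dot v w.
Proof. by rewrite !dotE !mxE; ring. Qed.

Lemma dotNl u v : dot (- u) v = - dot u v.
Proof. by rewrite !dotE !mxE; ring. Qed.

Lemma dotZl a u v : dot (a *: u) v = a * dot u v.
Proof. by rewrite !dotE !mxE; ring. Qed.

Lemma dotDr u v w : dot u (v + w) = dot u v + dot u w.
Proof. by rewrite !dotE !mxE; ring. Qed.

Lemma dotNr u v : dot u (- v) = - dot u v.
Proof. by rewrite !dotE !mxE; ring. Qed.

Lemma dotZr a u v : dot u (a *: v) = a * dot u v.
Proof. by rewrite !dotE !mxE; ring. Qed.

Lemma dotBl u v w : dot (u - v) w = dot u w - dot v w.
Proof. by rewrite dotDl dotNl. Qed.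

Lemma dotBr u v w : dot u (v - w) = dot u v - dot u w.
Proof. by rewrite dotDr dotNr. Qed.

Lemma dot0l u : dot 0 u = 0.
Proof. by rewrite dotE !mxE !mul0r !addr0. Qed.

Definition dot_lin := (dotDl, dotNl, dotZl, dotDr, dotNr, dotZr).

Lemma dot_ge0 u : 0 <= dot u u.
Proof. by apply: sumr_ge0 => i _; rewrite -expr2 sqr_ge0. Qed.

Lemma enormE u : enorm u = Num.sqrt (dot u u).
Proof. by rewrite /enorm /dot; under eq_bigr do rewrite expr2. Qed.

Lemma sqr_enorm u : enorm u ^+ 2 = dot u u.
Proof. by rewrite enormE sqr_sqrtr ?dot_ge0. Qed.

Lemma enorm_ge0 u : 0 <= enorm u.
Proof. exact: sqrtr_ge0. Qed.

Lemma dot_eq0 u : (dot u u == 0) = (u == 0).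
Proof.
apply/eqP/eqP => [u0|->]; last exact: dot0l.
apply/rowP => i; rewrite mxE; apply/eqP; rewrite -sqrf_eq0 expr2.
have := psumr_eq0P (P := xpredT) (F := fun i => u 0 i * u 0 i) _ u0.
by move=> ->// j _; rewrite -expr2 sqr_ge0.
Qed.

Lemma enorm_eq0 u : (enorm u == 0) = (u == 0).
Proof. by rewrite -sqrf_eq0 sqr_enorm dot_eq0. Qed.

Lemma enorm_gt0 u : (0 < enorm u) = (u != 0).
Proof. by rewrite lt_neqAle enorm_ge0 andbT eq_sym enorm_eq0. Qed.

Lemma enorm0 : enorm (0 : 'E3[R]) = 0.
Proof. by apply/eqP; rewrite enorm_eq0. Qed.

Lemma enormZ a u : enorm (a *: u) = `|a| * enorm u.
Proof.
by rewrite !enormE dotZl dotZr mulrA -expr2 sqrtrM ?sqr_ge0// sqrtr_sqr.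
Qed.

Lemma enormN u : enorm (- u) = enorm u.
Proof. by rewrite -scaleN1r enormZ normrN1 mul1r. Qed.

Lemma enormBC u v : enorm (u - v) = enorm (v - u).
Proof. by rewrite -enormN opprB. Qed.

Lemma ler_enorm_sqr u v : (enorm u <= enorm v) = (dot u u <= dot v v).
Proof. by rewrite -!sqr_enorm ler_sqr ?nnegrE ?enorm_ge0. Qed.

Lemma dot_le u v : dot u v <= enorm u * enorm v.
Proof.
have [->|v0] := eqVneq v 0.
  by rewrite dotC dot0l enorm0 mulr0.
rewrite real_leNgt ?num_real //; apply/negP => lt.
have := dot_ge0 (dot v v *: u - dot u v *: v).
rewrite !dot_lin (dotC v u) => ge.
have v_gt0 : 0 < dot v v by rewrite lt0r dot_ge0 dot_eq0 v0.
have : dot u v ^+ 2 <= dot u u * dot v v.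
  rewrite -(ler_pM2l v_gt0); move: ge; lra.
rewrite -!sqr_enorm -exprMn ler_sqr ?nnegrE ?mulr_ge0 ?enorm_ge0//; last first.
  by apply/ltW/le_lt_trans/lt; rewrite mulr_ge0 ?enorm_ge0.
by rewrite leNgt lt.
Qed.

Lemma ler_enormD u v : enorm (u + v) <= enorm u + enorm v.
Proof.
rewrite -ler_sqr ?nnegrE ?addr_ge0 ?enorm_ge0// sqrrD !sqr_enorm !dot_lin.
rewrite (dotC v u); have := dot_le u v; lra.
Qed.

Lemma ler_enormB u v w : enorm (u - w) <= enorm (u - v) + enorm (v - w).
Proof. by rewrite (le_trans _ (ler_enormD _ _))// addrA subrK. Qed.

Lemma normr_dot_le u v : `|dot u v| <= enorm u * enorm v.
Proof. by rewrite ler_norml dot_le andbT lerNl -dotNl -(enormN u) dot_le. Qed.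

Lemma normr_coord_le u i : `|u 0 i| <= enorm u.
Proof.
rewrite -ler_sqr ?nnegrE ?enorm_ge0// sqr_enorm real_normK ?num_real//.
by rewrite /dot (bigD1 i)//= expr2 lerDl sumr_ge0// => j _; rewrite -expr2 sqr_ge0.
Qed.

Lemma normr_le_enorm u : `|u| <= enorm u.
Proof.
rewrite [leLHS]/Num.norm/= mx_normrE; apply: bigmax_le => [|[i j] _ /=].
  exact: enorm_ge0.
by rewrite (ord1 i) normr_coord_le.
Qed.

Lemma normr_coord u i : `|u 0 i| <= `|u|.
Proof.
by rewrite [leRHS]/Num.norm/= mx_normrE
  (le_bigmax _ (fun ij => `|u ij.1 ij.2|) (0, i)).
Qed.

(** The factor 2 is the square root of 3 rounded up; it reappears in later constants wherever a
    Euclidean bound is read in the sup norm or back. *)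
Lemma enorm_le_normr u : enorm u <= 2 * `|u|.
Proof.
rewrite -ler_sqr ?nnegrE ?enorm_ge0 ?mulr_ge0// sqr_enorm dotE.
have sqr_le k : u 0 k * u 0 k <= `|u| ^+ 2.
  by rewrite -expr2 -[leLHS]real_normK ?num_real// ler_sqr ?nnegrE// normr_coord.
have := sqr_le ord0; have := sqr_le (lift ord0 ord0).
have := sqr_le (lift ord0 (lift ord0 ord0)).
have := sqr_ge0 `|u|; lra.
Qed.

Lemma dotDD u v : dot (u + v) (u + v) = dot u u + 2 * dot u v + dot v v.
Proof. by rewrite !dot_lin (dotC v u); ring. Qed.

Lemma dotBB u v : dot (u - v) (u - v) = dot u u - 2 * dot u v + dot v v.
Proof. by rewrite !dot_lin (dotC v u); ring. Qed.

Lemma cvg_dot (T : Type) (F : set_system T) {FF : Filter F}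
    (f h : T -> 'E3[R]) u v :
  f @ F --> u -> h @ F --> v -> (fun x => dot (f x) (h x)) @ F --> dot u v.
Proof.
have coord i (k : T -> 'E3[R]) w : k @ F --> w -> (fun x => k x 0 i) @ F --> w 0 i.
  by move=> kw; exact: (cvg_comp _ _ kw (@coord_continuous R 1 3 0 i w)).
move=> fu hv; rewrite dotE; under eq_fun do rewrite dotE.
by apply: cvgD; [apply: cvgD|]; apply: cvgM;
  first [exact: (coord _ f u fu)|exact: (coord _ h v hv)].
Qed.

Lemma cvg_enorm (T : Type) (F : set_system T) {FF : Filter F}
    (f : T -> 'E3[R]) u :
  f @ F --> u -> (fun x => enorm (f x)) @ F --> enorm u.
Proof.
move=> fu; rewrite enormE; under eq_fun do rewrite enormE.
have duu := @cvg_dot _ F FF f f u u fu fu.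
by apply: continuous_cvg duu; exact: sqrt_continuous.
Qed.

End Euclid.

(** * Differential calculus of curves with Euclidean bounds *)

Section Derivative.
Variable R : realType.
Implicit Types (g : R -> 'E3[R]) (s t : R) (u v : 'E3[R]).

Lemma is_derive1P (V : normedModType R) (g : R -> V) (t : R) (v : V) :
  is_derive t 1 g v <-> h^-1 *: (g (h + t) - g t) @[h --> 0^'] --> v.
Proof.
have dE : derivable g t 1 = cvg (h^-1 *: (g (h + t) - g t) @[h --> 0^']).
  rewrite /derivable; set d := (fun _ : R => _); set d' := (fun _ : R => _).
  by suff -> : d = d' by []; apply/funext => h; rewrite /d /= [h%:A](mulr1 h).
split=> [[]|gv]; first by rewrite dE -derive1E => ? <-.
by split; rewrite ?dE -?derive1E; [apply/cvg_ex; exists v|exact: cvg_lim].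
Qed.

Lemma is_derive_derive1 (V : normedModType R) (g : R -> V) (t : R) :
  derivable g t 1 -> is_derive t 1 g (derive1 g t).
Proof. by move=> gt; rewrite derive1E; exact: derivableP. Qed.

Lemma derive1_val (V : normedModType R) (g : R -> V) (t : R) (v : V) :
  is_derive t 1 g v -> derive1 g t = v.
Proof. by move=> gv; rewrite derive1E derive_val. Qed.

Lemma is_derive_continuous (V : normedModType R) (g : R -> V) (t : R) (v : V) :
  is_derive t 1 g v -> {for t, continuous g}.
Proof.
by move=> [gt _]; apply: differentiable_continuous; exact/derivable1_diffP.
Qed.

Lemma is_derive_dot g u t v :
  is_derive t 1 g v -> is_derive t 1 (fun s => dot (g s) u) (dot v u).
Proof.
move=> /is_derive1P gv; apply/is_derive1P.
under eq_fun do rewrite -dotBl [_ *: _](esym (dotZl _ _ _)).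
by apply: cvg_dot gv _; exact: cvg_cst.
Qed.

Lemma is_derive_dot_sqr g t v : is_derive t 1 g v ->
  is_derive t 1 (fun s => dot (g s) (g s)) (2 * dot v (g t)).
Proof.
move=> gv; have gt := is_derive_continuous gv; move/is_derive1P in gv.
have {}gt : (fun h => g (h + t)) @ 0^' --> g t.
  rewrite -[X in _ --> g X](add0r t).
  apply: cvg_within_filter.
  apply: (@continuous_comp _ _ _ (fun h => h + t) g); last by rewrite add0r.
  by apply: cvgD; [exact: cvg_id|exact: cvg_cst].
apply/is_derive1P.
have -> : 2 * dot v (g t) = dot v (g t + g t) by rewrite dotDr; ring.
have E h : h^-1 *: (dot (g (h + t)) (g (h + t)) - dot (g t) (g t)) =
    dot (h^-1 *: (g (h + t) - g t)) (g (h + t) + g t).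
  by rewrite [LHS]/GRing.scale/= !dot_lin (dotC (g t) (g (h + t))); ring.
under eq_fun do rewrite E.
by apply: cvg_dot gv _; apply: cvgD gt _; exact: cvg_cst.
Qed.

(** The mean value theorem fails for vectors, so it is applied to the scalar function [dot (g s) d]
    with [d] the total displacement, and [enorm d] is then cancelled once. *)
Lemma mean_value_enorm g g' (s t C : R) : s <= t ->
  (forall x : R, is_derive x 1 g (g' x)) ->
  (forall x, s <= x <= t -> enorm (g' x) <= C) ->
  enorm (g t - g s) <= C * (t - s).
Proof.
move=> st gg' g'C; set d := g t - g s.
have [->|d0] := eqVneq d 0.
  rewrite enorm0 mulr_ge0 ?subr_ge0//.
  by rewrite (le_trans (enorm_ge0 (g' s)))// g'C// lexx.
have dd (x : R) : is_derive x 1 (fun s => dot (g s) d) (dot (g' x) d).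
  exact: is_derive_dot.
have cd : {within `[s, t], continuous (fun s => dot (g s) d)}.
  by apply: continuous_subspaceT => x; exact: is_derive_continuous (dd x).
have [x] := MVT_segment st (fun x _ => dd x) cd; rewrite in_itv/= => xst.
rewrite -dotBl -/d -sqr_enorm => E.
have dgt0 : 0 < enorm d by rewrite enorm_gt0.
rewrite -(ler_pM2l dgt0) -expr2 E.
rewrite mulrA ler_wpM2r ?subr_ge0// (le_trans (dot_le _ _))//.
by rewrite mulrC ler_wpM2l ?enorm_ge0// g'C.
Qed.

Lemma mean_value_enorm_sym g g' C :
  (forall x : R, is_derive x 1 g (g' x)) -> (forall x, enorm (g' x) <= C) ->
  forall s t, enorm (g t - g s) <= C * `|t - s|.
Proof.
move=> gg' g'C s t; have [st|/ltW ts] := leP s t.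
  by rewrite ger0_norm ?subr_ge0//; apply: mean_value_enorm gg' _ => // x _.
rewrite enormBC distrC ger0_norm ?subr_ge0//.
by apply: mean_value_enorm gg' _ => // x _.
Qed.

(** This recognises a derivative from inequalities between values only, so that it can be used on
    pointwise limits of curves. *)
Lemma is_derive_quadratic g v (s M : R) :
  (forall t, enorm (g t - g s - (t - s) *: v) <= M * (t - s) ^+ 2) ->
  is_derive s 1 g v.
Proof.
move=> gM; apply/is_derive1P/cvgrPdist_le => e e0.
have M0 : 0 <= M.
  have := le_trans (enorm_ge0 _) (gM (1 + s)).
  by rewrite addrK expr1n mulr1.
near=> h.
have h0 : h != 0 by near: h; exact: nbhs_dnbhs_neq.
have -> : v - h^-1 *: (g (h + s) - g s) =
    - (h^-1 *: (g (h + s) - g s - (h + s - s) *: v)).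
  by rewrite addrK [in RHS]scalerBr scalerA mulVf// scale1r opprB.
rewrite normrN (le_trans (normr_le_enorm _))// enormZ.
have := gM (h + s); rewrite addrK => le.
rewrite (le_trans (ler_wpM2l (normr_ge0 _) le))//.
rewrite -[h ^+ 2]real_normK ?num_real// normfV expr2 mulrCA mulKf ?normr_eq0//.
rewrite (@le_trans _ _ ((M + 1) * `|h|))//.
  by rewrite ler_wpM2r// lerDl.
rewrite mulrC -ler_pdivlMr ?ltr_wpDl//.
near: h; apply: dnbhs0_le; rewrite divr_gt0// ltr_wpDl//.
Unshelve. all: by end_near. Qed.

Lemma is_derive_scale v (t : R) : is_derive t 1 (fun x : R => x *: v) v.
Proof.
apply: (@is_derive_quadratic _ _ _ 0) => x.
by rewrite -scalerBl subrr enorm0 mul0r.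
Qed.

Lemma taylor1_enorm g g' (M : R) :
  (forall x : R, is_derive x 1 g (g' x)) ->
  (forall s t, enorm (g' t - g' s) <= M * `|t - s|) ->
  forall s t, enorm (g t - g s - (t - s) *: g' s) <= M * (t - s) ^+ 2.
Proof.
move=> gg' g'M s t.
have M0 : 0 <= M.
  by have := le_trans (enorm_ge0 _) (g'M 0 1); rewrite subr0 normr1 mulr1.
pose k x := g x - x *: g' s.
have kk' (x : R) : is_derive x 1 k (g' x - g' s).
  by apply: is_deriveB; exact: is_derive_scale.
have -> : g t - g s - (t - s) *: g' s = k t - k s.
  by rewrite /k; apply/rowP => i; rewrite !mxE; ring.
have [st|/ltW ts] := leP s t.
  rewrite expr2 mulrA. apply: mean_value_enorm st kk' _ => x /andP[sx xt].
  by rewrite (le_trans (g'M _ _))// ler_wpM2l// ger0_norm ?subr_ge0// lerD2r.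
rewrite (enormBC (k t)) -sqrrN (opprB t s) expr2 mulrA.
apply: mean_value_enorm ts kk' _ => x /andP[tx xs].
rewrite (le_trans (g'M _ _))// ler_wpM2l// distrC ger0_norm ?subr_ge0//.
by rewrite lerD2l lerN2.
Qed.

End Derivative.

(** * Sets of reach at least 1 and the normal propagation of nearest points *)

Section Reach.
Variable R : realType.
Implicit Types (A : set 'E3[R]) (x y a b : 'E3[R]) (r e h : R).

Lemma continuous_enormB a : continuous (fun x => enorm (x - a)).
Proof.
move=> x; apply: (@cvg_enorm _ _ (nbhs x) _).
by apply: cvgB; [exact: cvg_id|exact: cvg_cst].
Qed.

Lemma compact_eball x r : compact [set y | enorm (y - x) <= r].
Proof.
apply: bounded_closed_compact.
  exists (r + `|x|); split; first by rewrite num_real.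
  move=> M /ltW rM y /= yr; rewrite -(subrK x y) (le_trans _ rM)//.
  by rewrite (le_trans (ler_normD _ _))// lerD2r (le_trans (normr_le_enorm _)).
exact: (@closed_comp _ _ _ [set z | z <= r]
  (fun z _ => @continuous_enormB x z) (@closed_le R r)).
Qed.

Lemma compact_esphere x r : compact [set y | enorm (y - x) = r].
Proof.
apply: (subclosed_compact _ (@compact_eball x r)); last by move=> y /= ->.
exact: (@closed_comp _ _ _ [set z | z = r]
  (fun z _ => @continuous_enormB x z) (@closed_eq R r)).
Qed.

Lemma set_dist_le A x a : A a -> set_dist x A <= enorm (x - a).
Proof.
move=> Aa; apply: ge_inf; last by exists a.
by exists 0 => _ [b _ <-]; exact: enorm_ge0.
Qed.

Lemma le_set_dist A x r : A !=set0 ->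
  (forall a, A a -> r <= enorm (x - a)) -> r <= set_dist x A.
Proof.
move=> [b Ab] rA; apply: lb_le_inf; first by exists (enorm (x - b)), b.
by move=> _ [a Aa <-]; exact: rA.
Qed.

Lemma set_dist_nearest A x a :
  nearest_point A x a -> set_dist x A = enorm (x - a).
Proof.
move=> [Aa an]; apply/eqP; rewrite eq_le set_dist_le//=.
by apply: le_set_dist => //; exists a.
Qed.

Lemma set_dist_lipschitz A x y : A !=set0 ->
  set_dist x A <= set_dist y A + enorm (x - y).
Proof.
move=> A0; rewrite -lerBlDr; apply: le_set_dist => // a Aa.
rewrite lerBlDr addrC (le_trans (set_dist_le x Aa))//; exact: ler_enormB.
Qed.

Lemma continuous_set_dist A : A !=set0 -> continuous (fun x => set_dist x A).
Proof.
move=> A0 x; apply/(@cvgrPdist_le _ _ _ (nbhs x) _) => e e0.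
have : (fun y => enorm (y - x)) @ (nbhs x) --> enorm (x - x).
  exact: continuous_enormB.
rewrite subrr enorm0 => /(@cvgrPdist_le _ _ _ (nbhs x) _)/(_ e e0).
apply: (@filterS _ (nbhs x) _) => y.
rewrite sub0r normrN ger0_norm ?enorm_ge0// => yx.
rewrite ler_norml; have := set_dist_lipschitz x y A0.
have := set_dist_lipschitz y x A0; rewrite (enormBC x y); lra.
Qed.

Lemma nearest_exists A x : A !=set0 -> compact A -> exists a, nearest_point A x a.
Proof.
move=> A0 cA.
have [|a aA amin] := @compact_EVT_min _ _ (fun a => enorm (a - x)) A A0 cA.
  by apply: continuous_subspaceT; exact: continuous_enormB.
exists a; split; first exact: set_mem.
by move=> b Ab; rewrite !(enormBC x) amin// inE.
Qed.

Definition unique_nearest A :=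
  forall x, set_dist x A < 1 -> exists! a, nearest_point A x a.

(** The supremum in [reach] may fail to be attained, but a point at distance strictly below 1
    already lies below some admissible radius. *)
Lemma reach_ge1P A : (1 <= reach A)%E <-> unique_nearest A.
Proof.
split=> [A1 x xA|uA]; last first.
  by apply: ereal_sup_ubound; exists 1 => //; split.
have : ((set_dist x A)%:E < reach A)%E by rewrite (lt_le_trans _ A1)// lte_fin.
by move=> /ereal_sup_gt[_ [r [r0 rA] <-]]; rewrite lte_fin; exact: rA.
Qed.

(** By compactness the points of [A] at distance at least [e] from [a] have a minimal distance to
    [y], which exceeds [enorm (y - a)] by uniqueness; [h] is this gap. *)
Lemma nearest_stable A y a e : compact A ->
  (forall b, nearest_point A y b -> b = a) -> nearest_point A y a -> 0 < e ->
  exists2 h, 0 < h &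
    forall b, A b -> enorm (y - b) < enorm (y - a) + h -> enorm (b - a) < e.
Proof.
move=> cA ua [Aa an] e0.
pose B := A `&` [set b | e <= enorm (b - a)].
have cB : compact B.
  apply: compact_closedI => //.
  exact: (@closed_comp _ _ _ [set z | e <= z]
    (fun z _ => @continuous_enormB a z) (@closed_ge R e)).
have [[b0 Bb0]|B0] := pselect (B !=set0); last first.
  exists 1 => // b Ab _; rewrite ltNge; apply/negP => eb.
  by apply: B0; exists b.
have [||b] := @compact_EVT_min _ _ (fun b => enorm (b - y)) B _ cB.
- by exists b0.
- by apply: continuous_subspaceT; exact: continuous_enormB.
rewrite inE => -[Ab /= eb] bmin.
have lt : enorm (y - a) < enorm (y - b).
  rewrite ltNge; apply/negP => le.
  have ba : b = a by apply: ua; split=> // c Ac; exact: le_trans le (an _ Ac).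
  by move: eb; rewrite ba subrr enorm0 leNgt e0.
exists (enorm (y - b) - enorm (y - a)); first by rewrite subr_gt0.
move=> c Ac; rewrite (addrC (enorm (y - a))) subrK ltNge => yc; rewrite ltNge.
apply: contra yc => ec; rewrite !(enormBC y); apply: bmin.
by rewrite inE.
Qed.

(** Moving straight away from [a] raises the distance at a rate close to 1: points that nearly
    realise the distance cluster at [a], hence are seen from [y] in nearly the same direction, and
    the other points have slack to spare. *)
Lemma set_dist_ascent A y a e : compact A ->
  (forall b, nearest_point A y b -> b = a) -> nearest_point A y a ->
  0 < enorm (y - a) -> 0 < e <= 1 ->
  exists2 h0, 0 < h0 & forall h, 0 < h <= h0 ->
    enorm (y - a) + (1 - e) * h <=
    set_dist (y + (h / enorm (y - a)) *: (y - a)) A.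
Proof.
move=> cA ua na; set u := y - a; set p := enorm u => p0 /andP[e0 e1].
have pe0 : 0 < p * e by rewrite mulr_gt0.
have [k k0] := nearest_stable cA ua na pe0; rewrite -/u -/p => kA.
(* A point with slack [k] loses at most [h] in the move, which leaves a surplus of at least
   [k - h >= h]. *)
exists (k / 2); first by rewrite divr_gt0.
move=> h /andP[h0 hk]; case: (na) => Aa an.
apply: le_set_dist => [|b Ab]; first by exists a.
set w := (h / p) *: u.
have w_norm : enorm w = h.
  by rewrite /w enormZ ger0_norm ?divr_ge0 ?ltW// -/p divfK ?gt_eqF.
have pe : enorm u = p by [].
have [yb|/(kA _ Ab) ba] := leP (p + k) (enorm (y - b)).
  have := ler_enormB (y - b) (y + w - b) 0.
  rewrite !subr0 (_ : y - b - (y + w - b) = - w); last first.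
    by apply/rowP => i; rewrite !mxE; ring.
  rewrite enormN w_norm.
  have : 0 <= e * h by rewrite mulr_ge0 ?ltW.
  lra.
rewrite -ler_sqr ?nnegrE ?enorm_ge0//; last first.
  by rewrite addr_ge0 ?(ltW p0)// mulr_ge0 ?subr_ge0// ltW.
rewrite sqr_enorm (_ : y + w - b = (y - b) + w); last by rewrite addrAC.
rewrite dotDD -!sqr_enorm w_norm.
have ybp : p ^+ 2 <= enorm (y - b) ^+ 2.
  by rewrite ler_sqr ?nnegrE ?enorm_ge0 ?an ?ltW.
have : h * (p - p * e) <= dot (y - b) w.
  rewrite /w dotZr -mulrA ler_pM2l// [leRHS]mulrC ler_pdivlMr//.
  rewrite (_ : y - b = u - (b - a)); last first.
    by rewrite /u; apply/rowP => i; rewrite !mxE; ring.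
  rewrite dotBl -sqr_enorm pe; have := dot_le (b - a) u; rewrite pe.
  have : enorm (b - a) * p <= p * e * p by rewrite ler_pM2r// ltW.
  lra.
have : 0 <= h ^+ 2 * (2 * e - e ^+ 2).
  rewrite mulr_ge0 ?sqr_ge0// subr_ge0 expr2 ler_wpM2r ?(ltW e0)//.
  by rewrite (le_trans e1)// ler1n.
clear -ybp; clearbody p w u; move: ybp; nra.
Qed.

(* Instead of following the gradient flow of the distance function, maximise
   the distance minus (1 - e) times the length travelled. *)
Lemma nearest_extend A x a r : compact A -> unique_nearest A ->
  nearest_point A x a -> 0 < enorm (x - a) -> enorm (x - a) <= r < 1 ->
  nearest_point A (a + (r / enorm (x - a)) *: (x - a)) a.
Proof.
move=> cA uA na; set r0 := enorm (x - a) => r0_gt0 /andP[r0r r1].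
have [Aa an] := na; have A0 : A !=set0 by exists a.
have xA : set_dist x A = r0 by rewrite (set_dist_nearest na).
set S := [set y | enorm (y - x) = r - r0].
have S0 : S !=set0.
  exists (x + ((r - r0) / r0) *: (x - a)); rewrite /S/= addrC addKr enormZ.
  by rewrite ger0_norm ?divr_ge0 ?subr_ge0 ?(ltW r0_gt0)// -/r0 divfK ?gt_eqF.
have [z] := compact_EVT_max S0 (@compact_esphere x (r - r0))
  (continuous_subspaceT (continuous_set_dist A0)).
rewrite inE /S/= => zx zmax.
(* A maximiser of the penalised distance over the ball must lie on the sphere: at an interior point
   the ascent rate 1 - e/2 would beat the price 1 - e. *)
have far e : 0 < e < 1 -> r0 + (1 - e) * (r - r0) <= set_dist z A.
  move=> /andP[e0 e1].
  pose f y := set_dist y A - (1 - e) * enorm (y - x).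
  have fc : continuous f.
    move=> y; apply: (@cvgB _ _ _ (nbhs y) _ (fun y => set_dist y A)).
      exact: continuous_set_dist.
    apply: (@cvgM _ _ (nbhs y) _ (fun=> 1 - e)); first exact: cvg_cst.
    exact: continuous_enormB.
  have B0 : [set y | enorm (y - x) <= r - r0] !=set0.
    by exists x => /=; rewrite subrr enorm0 subr_ge0.
  have [y] := compact_EVT_max B0 (@compact_eball x (r - r0))
    (continuous_subspaceT fc).
  rewrite inE/= => yx ymax.
  have fx : r0 <= f y.
    have : f x <= f y by apply: ymax; rewrite inE/= subrr enorm0 subr_ge0.
    by rewrite /f subrr enorm0 mulr0 subr0 xA.
  have [ys|yS] := eqVneq (enorm (y - x)) (r - r0).
    have : set_dist y A <= set_dist z A by apply: zmax; rewrite inE.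
    by move: fx; rewrite /f ys; lra.
  have {yS}yS : enorm (y - x) < r - r0 by rewrite lt_neqAle yS.
  have yd : set_dist y A <= r0 + enorm (y - x).
    by rewrite -xA; exact: set_dist_lipschitz.
  have [|b [nb ub]] := uA y; first by lra.
  have yb := set_dist_nearest nb.
  have yb0 : 0 < enorm (y - b).
    rewrite -yb (lt_le_trans r0_gt0)// (le_trans fx)// /f gerBl mulr_ge0//.
      by rewrite subr_ge0 ltW.
    exact: enorm_ge0.
  have e2 : 0 < e / 2 <= 1 by lra.
  have [h0 h0_gt0 asc] := @set_dist_ascent A y b (e / 2) cA
    (fun c nc => esym (ub c nc)) nb yb0 e2.
  pose h := Num.min h0 (r - r0 - enorm (y - x)).
  have h_gt0 : 0 < h by rewrite lt_min h0_gt0 subr_gt0.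
  have hh0 : h <= h0 by rewrite ge_min lexx.
  have hyx : h <= r - r0 - enorm (y - x) by rewrite ge_min lexx orbT.
  have {asc} := asc h; rewrite h_gt0 hh0 => /(_ isT).
  set y' := y + _ *: _ => asc.
  have y'x : enorm (y' - x) <= h + enorm (y - x).
    rewrite /y' addrAC (addrC (y - x)) (le_trans (ler_enormD _ _))// lerD2r enormZ.
    by rewrite ger0_norm ?divr_ge0 ?(ltW h_gt0) ?(ltW yb0)// divfK ?gt_eqF.
  have : f y' <= f y by apply: ymax; rewrite inE/=; lra.
  rewrite /f yb.
  have : (1 - e) * enorm (y' - x) <= (1 - e) * (h + enorm (y - x)).
    by rewrite ler_pM2l// subr_gt0.
  have : 0 < e * h by rewrite mulr_gt0.
  clear -asc; move: asc; lra.
have zr : r <= set_dist z A.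
  apply/ler_addgt0Pr => e e0.
  have [re|re] := leP (r - r0) e.
    have half : 0 < (1 / 2 : R) < 1 by lra.
    by have := far _ half; lra.
  have rr : 0 < r - r0 by rewrite (lt_trans e0).
  have := far (e / (r - r0)).
  rewrite divr_gt0//= ltr_pdivrMr// mul1r re => /(_ isT).
  rewrite mulrBl mul1r divfK ?gt_eqF//; lra.
have za : enorm (z - a) = r.
  apply/eqP; rewrite eq_le (le_trans zr (set_dist_le _ Aa)) andbT.
  by have := ler_enormB z x a; rewrite zx -/r0; lra.
suff <- : z = a + (r / r0) *: (x - a).
  split=> // b Ab; rewrite za; exact: le_trans zr (set_dist_le _ Ab).
(* The lengths r = (r - r0) + r0 give equality in the triangle inequality for [z], [x], [a], which
   puts [z] on the ray from [a] through [x]. *)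
have dzx : dot (z - x) (x - a) = (r - r0) * r0.
  have := dotDD (z - x) (x - a); rewrite addrA subrK -!sqr_enorm za zx -/r0.
  by lra.
apply/eqP; rewrite -subr_eq0 -dot_eq0.
have -> : z - (a + (r / r0) *: (x - a)) = (z - x) - ((r - r0) / r0) *: (x - a).
  apply/rowP => i; rewrite !mxE; field.
  by rewrite gt_eqF.
rewrite dotBB !(dotZl, dotZr) dzx -!sqr_enorm zx -/r0; apply/eqP; field.
by rewrite gt_eqF.
Qed.

End Reach.

(** * Curves on the circle, their periodicity and compactness *)

Section Circle.
Variable R : realType.
Implicit Types (s t : R) (g v : R -> 'E3[R]) (c : R).

Lemma pi2_gt0 : 0 < 2 * pi :> R.
Proof. by rewrite mulr_gt0 ?pi_gt0. Qed.

Lemma circle_eq_sym s t : circle_eq s t -> circle_eq t s.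
Proof. by move=> [n ->]; exists (- n); rewrite mulrNz mulrN addrK. Qed.

Lemma circle_eq_near s t : circle_eq s t -> `|t - s| < 2 * pi -> t = s.
Proof.
move=> [n ->]; rewrite (addrC s) addrK normrM gtr0_norm ?pi2_gt0//.
rewrite gtr_pMr ?pi2_gt0// -intr_norm -[ltRHS]/(1%:~R) ltr_int.
by case: n => [[|n]|n]// _; rewrite mulr0 add0r.
Qed.

Lemma circle_eq_in s t : exists2 t', circle_eq t t' & s <= t' < s + 2 * pi.
Proof.
pose n := Num.floor ((t - s) / (2 * pi)).
have /andP[nt tn] : n%:~R <= (t - s) / (2 * pi) < n%:~R + 1.
  by rewrite -(intrD1) real_floor_itv ?num_real.
exists (t - 2 * pi * n%:~R); first by exists (- n); rewrite mulrNz mulrN.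
rewrite ler_pdivlMr ?pi2_gt0// in nt; rewrite ltr_pdivrMr ?pi2_gt0// in tn.
by apply/andP; split; move: nt tn; lra.
Qed.

Lemma circle_eq_dist s t : exists2 t', circle_eq t t' & `|t' - s| <= pi.
Proof.
have [t' tt' /andP[st' t's]] := circle_eq_in (s - pi) t.
by exists t' => //; rewrite ler_norml; apply/andP; split; lra.
Qed.

(** The velocity is a separate argument so that a limit of velocities can be handled before it is
    known to be a derivative. *)
Definition constant_speed_knot g v c :=
  [/\ circle_injection g, forall t, is_derive t 1 g (v t), continuous v,
      0 < c & forall t, enorm (v t) = c].

Lemma circle_injection_eq g s t : circle_injection g -> circle_eq s t -> g s = g t.
Proof. by move=> gi st; apply/gi. Qed.

Lemma continuous_knot g v c : constant_speed_knot g v c -> continuous g.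
Proof. by move=> [_ gv _ _ _] t; exact: is_derive_continuous (gv t). Qed.

Lemma derive_circle_eq g v s t : circle_injection g ->
  (forall t, is_derive t 1 g (v t)) -> circle_eq s t -> v s = v t.
Proof.
move=> gi gv [n tE]; have /is_derive1P gs := gv s; have /is_derive1P := gv t.
have E h : g (h + t) = g (h + s).
  by apply/gi/circle_eq_sym; exists n; rewrite tE addrA.
have E0 : g t = g s by have := E 0; rewrite !add0r.
under eq_fun do rewrite E E0.
exact: (cvg_unique _ gs).
Qed.

Lemma knot_lipschitz g v c : constant_speed_knot g v c ->
  forall s t, enorm (g t - g s) <= c * `|t - s|.
Proof.
by move=> [_ gv _ _ vc]; apply: mean_value_enorm_sym gv _ => t; rewrite vc.
Qed.

Lemma compact_knot_range g v c : constant_speed_knot g v c -> compact (range g).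
Proof.
move=> gvc; have [gi _ _ _ _] := gvc.
have -> : range g = g @` `[0, 2 * pi].
  apply/seteqP; split=> _ [t _ <-]; last by exists t.
  have [t' tt' /andP[t0 t1]] := circle_eq_in 0 t.
  exists t'; last exact/esym/gi.
  by rewrite /= in_itv/= t0 ltW// -[ltRHS]add0r.
apply: continuous_compact; last exact: segment_compact.
by apply: continuous_subspaceT; exact: continuous_knot gvc.
Qed.

(** The constant comes from compactness and depends on the curve and on [s]; it only serves to start
    the propagation of nearest points, before the uniform chord-arc bound is available. *)
Lemma knot_separation g v c s (e : R) : constant_speed_knot g v c ->
  0 < e -> exists2 m, 0 < m &
    forall t, e <= `|t - s| <= pi -> m <= enorm (g t - g s).
Proof.
move=> gvc e0; have [gi _ _ _ _] := gvc.
pose S := `[s - pi, s + pi]%classic `&` [set t : R | e <= `|t - s|].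
have inS t : e <= `|t - s| <= pi -> t \in S.
  move=> /andP[et tp]; rewrite inE; split=> //=; rewrite in_itv/=.
  by move: tp; rewrite ler_norml => /andP[? ?]; apply/andP; split; lra.
have cS : compact S.
  apply: compact_closedI; first exact: segment_compact.
  have nc : continuous (fun t : R => `|t - s|).
    move=> t; apply: (@cvg_norm _ _ _ (nbhs t)).
    by apply: cvgB; [exact: cvg_id|exact: cvg_cst].
  exact: (@closed_comp _ _ _ [set z : R | e <= z] (fun z _ => nc z)
    (@closed_ge R e)).
have [S0|S0] := pselect (S !=set0); last first.
  by exists 1 => // t /inS tS; exfalso; apply: S0; exists t; exact: set_mem.
have gc : continuous (fun t => enorm (g t - g s)).
  move=> t; apply: (@cvg_enorm _ _ (nbhs t) _).
  by apply: cvgB; [exact: continuous_knot gvc t|exact: cvg_cst].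
have [t] := compact_EVT_min S0 cS (continuous_subspaceT gc).
rewrite inE => -[/=]; rewrite in_itv/= => /andP[t1 t2] et tmin.
exists (enorm (g t - g s)); last by move=> t' /inS /tmin.
rewrite enorm_gt0 subr_eq0; apply/eqP => /esym/gi/circle_eq_near near.
have pi_gt0 := pi_gt0 R.
suff ts : t = s by move: et; rewrite ts subrr normr0 leNgt e0.
by apply: near; rewrite ltr_norml; apply/andP; split; lra.
Qed.

End Circle.

(** * Equivalence of thickness at least 1 with empty tangent unit balls *)

Section TangentBalls.
Variable R : realType.
Implicit Types (s t c : R) (g v : R -> 'E3[R]) (x d u w : 'E3[R]).

(* No point of g lies inside a unit ball tangent to g at g s: writing d for
   g t - g s, the component of d normal to v s has norm at most |d|^2 / 2. *)
Definition tangent_balls g v c := forall s t, let d := g t - g s in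
  dot d d * c ^+ 2 - dot d (v s) ^+ 2 <= c ^+ 2 * dot d d ^+ 2 / 4.

(** Close to [s] the numerator is of second order by Taylor while the chord is at least (c/2)|t -
    s|; away from [s] the chord is bounded below. Geometrically, some ball tangent at [g s] with
    centre in direction [u] is empty. *)
Lemma normal_push g v c (M : R) s : constant_speed_knot g v c ->
  (forall s t, enorm (v t - v s) <= M * `|t - s|) ->
  exists2 k, 0 < k & forall t u, enorm u = 1 -> dot u (v s) = 0 ->
    dot (g t - g s) u <= k * dot (g t - g s) (g t - g s).
Proof.
move=> gvc vM; have [gi gv _ c0 vc] := gvc.
have tay := taylor1_enorm gv vM.
have M0 : 0 <= M.
  by have := le_trans (enorm_ge0 _) (vM 0 1); rewrite subr0 normr1 mulr1.
(* Chosen so that the Taylor error stays below half of the linear term; [M + 1] guards against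
   division by zero. *)
pose e := c / (2 * (M + 1)).
have M1 : 0 < M + 1 by rewrite ltr_wpDl.
have e0 : 0 < e by rewrite divr_gt0// mulr_gt0.
have eM : M * e <= c / 2.
  rewrite /e invfM [leLHS](_ : _ = c / 2 * (M / (M + 1))); last by ring.
  rewrite ler_piMr//; first by rewrite divr_ge0// ltW.
  by rewrite ler_pdivrMr// mul1r lerDl.
have [m m0 gm] := knot_separation s gvc e0.
exists (Num.max (4 * M / c ^+ 2) m^-1).
  by rewrite lt_max invr_gt0 m0 orbT.
move=> t u u1 uv.
have [t' tt' t's] := circle_eq_dist s t; rewrite (circle_injection_eq gi tt').
set d := g t' - g s.
have dd0 := dot_ge0 d.
have [et|te] := leP e `|t' - s|.
  rewrite (@le_trans _ _ (m^-1 * dot d d))//; last first.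
    by rewrite ler_wpM2r// le_max lexx orbT.
  rewrite mulrC ler_pdivlMr// -sqr_enorm expr2.
  have := dot_le d u; rewrite u1 mulr1 => le.
  have md : m <= enorm d by apply: gm; rewrite et t's.
  by rewrite (le_trans (ler_wpM2r (ltW m0) le))// ler_wpM2l// enorm_ge0.
rewrite (@le_trans _ _ (4 * M / c ^+ 2 * dot d d))//; last first.
  by rewrite ler_wpM2r// le_max lexx.
have lo : c / 2 * `|t' - s| <= enorm d.
  have := tay s t'; rewrite -/d => le.
  have : c * `|t' - s| <= enorm d + M * (t' - s) ^+ 2.
    rewrite -(vc s) mulrC -enormZ.
    have := ler_enormB ((t' - s) *: v s) d 0; rewrite !subr0 enormBC; lra.
  have : M * (t' - s) ^+ 2 <= c / 2 * `|t' - s|.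
    rewrite -[(t' - s) ^+ 2]real_normK ?num_real// expr2 mulrA ler_wpM2r//.
    by rewrite (le_trans _ eM)// ler_wpM2l// ltW.
  lra.
have : dot d u <= M * (t' - s) ^+ 2.
  have -> : dot d u = dot (d - (t' - s) *: v s) u.
    by rewrite [RHS]dotBl dotZl (dotC (v s)) uv mulr0 subr0.
  by rewrite (le_trans (dot_le _ _))// u1 mulr1 tay.
move=> /le_trans; apply; rewrite -mulrA -mulrA [leRHS]mulrCA ler_wpM2l//.
rewrite mulrCA mulrC ler_pdivlMr ?exprn_gt0//.
have : (c / 2 * `|t' - s|) ^+ 2 <= enorm d ^+ 2.
  by rewrite ler_sqr// ?nnegrE ?enorm_ge0// mulr_ge0// divr_ge0// ltW.
rewrite exprMn real_normK ?num_real// sqr_enorm; lra.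
Qed.

Lemma normal_push_nearest g v c (M : R) s u : constant_speed_knot g v c ->
  (forall s t, enorm (v t - v s) <= M * `|t - s|) ->
  enorm u = 1 -> dot u (v s) = 0 ->
  exists2 r, 0 < r < 1 & nearest_point (range g) (g s + r *: u) (g s).
Proof.
move=> gvc vM u1 uv; have [k k0 gk] := normal_push s gvc vM.
(* Emptiness of the ball needs 2 r k <= 1, and the same choice keeps r < 1. *)
pose r := (2 * (k + 1))^-1.
have k1 : 0 < k + 1 by rewrite ltr_wpDl ?ltW.
have r0 : 0 < r by rewrite invr_gt0 mulr_gt0.
have rk : r * (2 * (k + 1)) = 1 by rewrite mulVf// gt_eqF ?mulr_gt0.
have rk0 : 0 < r * k by rewrite mulr_gt0.
exists r; first by apply/andP; split=> //; lra.
split; first by exists s.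
move=> _ [t _ <-]; rewrite addrAC subrr add0r ler_enorm_sqr.
rewrite (_ : g s + r *: u - g t = r *: u - (g t - g s)); last first.
  by apply/rowP => i; rewrite !mxE; ring.
rewrite dotBB (dotZl r u (g t - g s)) (dotC u (g t - g s)).
have dd0 := dot_ge0 (g t - g s).
have := ler_wpM2l (ltW r0) (gk t u u1 uv).
have : r * (k * dot (g t - g s) (g t - g s)) <= dot (g t - g s) (g t - g s) / 2.
  rewrite mulrA [leRHS]mulrC ler_wpM2r//; lra.
lra.
Qed.

(** Let [u] be the direction of the part [n] of the chord normal to [v s]. The point [g s] stays
    nearest to [g s + q *: u] for all q < 1 close to 1; expanding |q u - d| >= q gives 2 q |n| <=
    |d|^2, and [q] tends to 1. *)
Lemma thick_tangent_balls g v c (M : R) : constant_speed_knot g v c ->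
  (forall s t, enorm (v t - v s) <= M * `|t - s|) ->
  unique_nearest (range g) -> tangent_balls g v c.
Proof.
move=> gvc vM ug s t /=; have [gi gv _ c0 vc] := gvc.
have [d dE] : exists d, d = g t - g s by exists (g t - g s).
rewrite -!dE; have cc : dot (v s) (v s) = c ^+ 2 by rewrite -sqr_enorm vc.
have [n nE] : exists n, n = d - (dot d (v s) / c ^+ 2) *: v s.
  by exists (d - (dot d (v s) / c ^+ 2) *: v s).
have c2 : 0 < c ^+ 2 by rewrite exprn_gt0.
have nv : dot n (v s) = 0.
  by rewrite nE dotBl dotZl cc divfK ?subrr// gt_eqF.
have nd : dot d n = dot n n.
  by rewrite {2}nE dotBl dotZl (dotC (v s)) nv mulr0 subr0.
have nnE : dot n n * c ^+ 2 = dot d d * c ^+ 2 - dot d (v s) ^+ 2.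
  rewrite -nd nE dotBr dotZr; field.
  by rewrite gt_eqF.
rewrite -nnE [leLHS]mulrC -mulrA ler_pM2l//.
have [n0|n0] := eqVneq n 0.
  by rewrite n0 dot0l divr_ge0 ?sqr_ge0.
have ngt0 : 0 < enorm n by rewrite enorm_gt0.
pose u := (enorm n)^-1 *: n.
have u1 : enorm u = 1.
  by rewrite enormZ ger0_norm ?invr_ge0 ?enorm_ge0// mulVf// gt_eqF.
have uv : dot u (v s) = 0 by rewrite dotZl nv mulr0.
have [r /andP[r0 r1] nr] := normal_push_nearest gvc vM u1 uv.
have ru : g s + r *: u - g s = r *: u by rewrite addrAC subrr add0r.
have run : enorm (r *: u) = r by rewrite enormZ u1 mulr1 gtr0_norm.
have du : dot d u = enorm n.
  by rewrite dotZr nd -sqr_enorm expr2 mulKf// gt_eqF.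
have push q : r <= q < 1 -> 2 * q * enorm n <= dot d d.
  move=> /andP[rq q1].
  have pos : 0 < enorm (g s + r *: u - g s) by rewrite ru run.
  have rq1 : enorm (g s + r *: u - g s) <= q < 1 by rewrite ru run rq.
  have [_ ext] := nearest_extend (compact_knot_range gvc) ug nr pos rq1.
  have := ext (g t) (imageT g t); rewrite ru run scalerA divfK ?gt_eqF//.
  rewrite addrAC subrr add0r ler_enorm_sqr.
  rewrite (_ : g s + q *: u - g t = q *: u - d); last first.
    by rewrite dE; apply/rowP => i; rewrite !mxE; ring.
  rewrite dotBB (dotZl q u d) (dotC u d) du; lra.
have n2 : 2 * enorm n <= dot d d.
  apply/ler_addgt0Pr => e e0.
  (* The second term makes the loss 2(1 - q)|n| at most [e]; the first keeps [q] above the radius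
     already reached. *)
  pose q := Num.max r (1 - e / (2 * (enorm n + 1))).
  have N1 : 0 < enorm n + 1 by rewrite ltr_wpDl ?enorm_ge0.
  have f0 : 0 < e / (2 * (enorm n + 1)) by rewrite divr_gt0// mulr_gt0.
  have rq : r <= q < 1 by rewrite /q le_max lexx gt_max r1/= ltrBlDr ltrDl.
  have := push q rq.
  have : 1 - e / (2 * (enorm n + 1)) <= q by rewrite /q le_max lexx orbT.
  move: f0; set f := e / _ => f0 fq.
  have fe : f * (2 * (enorm n + 1)) = e by rewrite divfK// gt_eqF ?mulr_gt0.
  have := ler_wpM2r (ltW ngt0) fq.
  clearbody q f; move: fe ngt0 f0; lra.
have : (2 * enorm n) ^+ 2 <= dot d d ^+ 2.
  by rewrite ler_sqr ?nnegrE ?dot_ge0// mulr_ge0// ltW.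
rewrite exprMn sqr_enorm; lra.
Qed.

Lemma nearest_point_normal g v c x s : constant_speed_knot g v c ->
  nearest_point (range g) x (g s) -> dot (x - g s) (v s) = 0.
Proof.
move=> [_ gv _ _ _] [_ gs].
have gx (t : R) : is_derive t 1 (fun t => g t - x) (v t).
  have := is_deriveB (gv t) (is_derive_cst x t 1); rewrite subr0.
  exact.
have ds := is_derive_dot_sqr (gx s).
have : is_derive s 1 (fun t => dot (g t - x) (g t - x)) 0.
  apply: (@derive1_at_min _ _ (s - 1) (s + 1)).
  - by lra.
  - by move=> t _; case: (is_derive_dot_sqr (gx t)).
  - by rewrite in_itv/=; apply/andP; split; lra.
  - by move=> t _; rewrite -ler_enorm_sqr !(enormBC _ x); apply: gs; exists t.
move=> [_ d0]; have := @derive_val _ _ _ _ _ _ _ ds; rewrite d0 => /eqP.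
rewrite eq_sym mulf_eq0 pnatr_eq0/= -(opprB x) dotNr oppr_eq0 dotC => /eqP.
exact.
Qed.

(** If [g s] and [g t] are both nearest to [x], then y = x - g s is normal to [v s] and 2 y.d =
    |d|^2. The normal part of [d] has norm at most |d|^2 / 2, so Cauchy-Schwarz would need |y| >= 1
    unless d = 0. In the proof [n] is that normal part times c^2, to avoid division. *)
Lemma tangent_balls_thick g v c : constant_speed_knot g v c ->
  tangent_balls g v c -> unique_nearest (range g).
Proof.
move=> gvc tb x x1; have [gi gv _ c0 vc] := gvc.
have g0 : range g !=set0 by exists (g 0), 0.
have [a na] := nearest_exists x g0 (compact_knot_range gvc).
exists a; split=> // b nb.
have [[s _ sa] _] := na; have [[t _ tb'] _] := nb.
have xa := set_dist_nearest na; have xb := set_dist_nearest nb.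
subst a b; apply/esym/eqP; rewrite -subr_eq0.
have xv := nearest_point_normal gvc na.
have := tb s t => /=; set d := g t - g s.
set y := x - g s in xv.
have yd : 2 * dot y d = dot d d.
  have : dot y y = dot (y - d) (y - d).
    have -> : y - d = x - g t by rewrite /y /d; apply/rowP => i; rewrite !mxE; ring.
    by rewrite -!sqr_enorm -xa -xb.
  by rewrite dotBB; lra.
have yy : dot y y < 1.
  have y1 : enorm y < 1 by rewrite -xa.
  by rewrite -sqr_enorm expr_lt1// enorm_ge0.
have cc : dot (v s) (v s) = c ^+ 2 by rewrite -sqr_enorm vc.
have c2 : 0 < c ^+ 2 by rewrite exprn_gt0.
pose n := c ^+ 2 *: d - dot d (v s) *: v s.
have yn : dot y n = c ^+ 2 * dot y d.
  by rewrite /n dotBr !dotZr xv mulr0 subr0.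
have nn : dot n n = c ^+ 2 * (dot d d * c ^+ 2 - dot d (v s) ^+ 2).
  by rewrite /n dotBB !(dotZl, dotZr) cc; ring.
have cs : dot y n ^+ 2 <= dot y y * dot n n.
  rewrite -!sqr_enorm -exprMn -[leLHS]real_normK ?num_real//.
  rewrite ler_sqr ?nnegrE ?mulr_ge0 ?enorm_ge0//; exact: normr_dot_le.
rewrite -dot_eq0 -sqrf_eq0 => le.
have := dot_ge0 y; rewrite le_eqVlt => /orP[/eqP y0|y0].
  have : y == 0 by rewrite -dot_eq0 y0.
  by move/eqP => y00; rewrite -yd y00 dot0l mulr0 expr0n.
have D2 : dot d d ^+ 2 <= dot y y * dot d d ^+ 2.
  have c4 : 0 < (c ^+ 2) ^+ 2 / 4 by rewrite divr_gt0// exprn_gt0.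
  rewrite -(ler_pM2l c4).
  have -> : (c ^+ 2) ^+ 2 / 4 * dot d d ^+ 2 = dot y n ^+ 2.
    by rewrite yn -yd; field.
  apply: (le_trans cs); rewrite mulrCA ler_pM2l// nn.
  by have := ler_wpM2l (ltW c2) le; lra.
rewrite eq_le sqr_ge0 andbT leNgt; apply/negP => dd0.
by move: D2; rewrite leNgt gtr_pMl ?yy.
Qed.

End TangentBalls.

(** * Bounds for thick curves that depend on the speed alone *)

Section UniformEstimates.
Variables (R : realType) (g v : R -> 'E3[R]) (c : R).
Hypotheses (gvc : constant_speed_knot g v c) (tb : tangent_balls g v c).
Implicit Types s t h : R.

Let gi : circle_injection g. Proof. by case: gvc. Qed.
Let gv (t : R) : is_derive t 1 g (v t). Proof. by case: gvc. Qed.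
Let c0 : 0 < c. Proof. by case: gvc. Qed.
Let vc t : enorm (v t) = c. Proof. by case: gvc. Qed.
Let vv t : dot (v t) (v t) = c ^+ 2. Proof. by rewrite -sqr_enorm vc. Qed.

(** The chord is its own normal part, so |d| <= |d|^2 / 2. Hence the sign of the chord against the
    velocity cannot change while chords are shorter than 2. *)
Lemma tangent_balls_orthogonal s t : g t != g s ->
  dot (g t - g s) (v s) = 0 -> 2 <= enorm (g t - g s).
Proof.
move=> ts o; have := tb s t => /=; rewrite o expr0n subr0.
have d0 : 0 < enorm (g t - g s) by rewrite enorm_gt0 subr_eq0.
rewrite -sqr_enorm; set d := enorm _ in d0 *; clearbody d => le.
rewrite leNgt; apply/negP => d2.
have c2 : 0 < c ^+ 2 by rewrite exprn_gt0.
have {}le : d ^+ 2 <= (d ^+ 2) ^+ 2 / 4 by rewrite -(ler_pM2l c2); move: le; lra.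
have d22 : 0 < d ^+ 2 by rewrite exprn_gt0.
have : 1 <= d ^+ 2 / 4 by rewrite -(ler_pM2l d22) mulr1 mulrA -expr2.
have : d ^+ 2 < 2 ^+ 2 by rewrite ltr_sqr ?nnegrE// ltW.
lra.
Qed.

Lemma forward_initially s :
  exists2 e : R, 0 < e & forall h, 0 < `|h| < e ->
    0 < h * dot (g (s + h) - g s) (v s).
Proof.
have := is_derive_dot (v s) (gv s); rewrite vv => /is_derive1P.
have c2 : 0 < c ^+ 2 by rewrite exprn_gt0.
move=> /cvgr_gt /(_ _ c2) [e /= e0 gte]; exists e => // h /andP[h0 he].
have hn0 : h != 0 by rewrite -normr_gt0.
have := gte h; rewrite /= sub0r normrN => /(_ he hn0).
rewrite -dotBl (addrC h) [_ *: _]/GRing.scale/= => gt.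
have h2 : 0 < h ^+ 2 by rewrite exprn_even_gt0.
by have := mulr_gt0 h2 gt; rewrite mulrA expr2 mulfK.
Qed.

(** The sign is right for small [a]; a sign change along the way would, by the intermediate value
    theorem, produce a chord orthogonal to [v s] and shorter than 2. *)
Lemma tangent_balls_forward s h : 0 < `|h| < 2 * pi ->
  (forall a : R, 0 < a <= 1 -> enorm (g (s + a * h) - g s) < 2) ->
  0 < h * dot (g (s + h) - g s) (v s).
Proof.
move=> /andP[h0 h2pi] close; rewrite ltNge; apply/negP => f1.
have [e e0 ini] := forward_initially s.
pose a0 := Num.min 1 (e / (2 * `|h|)).
have a0_gt0 : 0 < a0 by rewrite lt_min ltr01 divr_gt0// mulr_gt0.
have a0_le1 : a0 <= 1 by rewrite ge_min lexx.
pose f a := h * dot (g (s + a * h) - g s) (v s).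
have f0 : 0 < f a0.
  have : 0 < a0 * h * dot (g (s + a0 * h) - g s) (v s).
    apply: ini; rewrite normrM (gtr0_norm a0_gt0) mulr_gt0//=.
    have : a0 <= e / (2 * `|h|) by rewrite ge_min lexx orbT.
    rewrite ler_pdivlMr ?mulr_gt0//; lra.
  by rewrite -mulrA pmulr_rgt0.
have fc : {within `[a0, 1], continuous f}.
  apply: continuous_subspaceT => a.
  have gc : {for a, continuous (g \o (fun a => s + a * h))}.
    apply: continuous_comp; last exact: continuous_knot gvc _.
    by apply: cvgD; [exact: cvg_cst|apply: cvgM; [exact: cvg_id|exact: cvg_cst]].
  apply: (@cvgM _ _ (nbhs a) _ (fun=> h)); first exact: cvg_cst.
  apply: (@cvg_dot _ _ (nbhs a) _); last exact: cvg_cst.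
  by apply: cvgB; [exact: gc|exact: cvg_cst].
have [|a] := @IVT _ f a0 1 0 a0_le1 fc.
  by rewrite ge_min le_max {2 4}/f mul1r f1 (ltW f0) orbT.
rewrite in_itv/= => /andP[a0a a1] /eqP; rewrite mulf_eq0.
have a_gt0 := lt_le_trans a0_gt0 a0a.
rewrite -normr_eq0 gt_eqF//= => /eqP fa0.
have a01 : 0 < a <= 1 by rewrite a_gt0.
have := close a a01; rewrite ltNge => /negP; apply.
apply: tangent_balls_orthogonal fa0; apply/eqP => /esym/gi/circle_eq_near.
rewrite addrAC subrr add0r normrM gtr0_norm// => /(_ _)E.
have : s + a * h = s.
  by apply: E; rewrite (le_lt_trans _ h2pi)// ler_piMl.
move/(canRL (addKr s)); rewrite addNr => /eqP; rewrite mulf_eq0.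
by rewrite -[h == 0]normr_eq0 !gt_eqF.
Qed.

(** If c pi < 2, every point is within distance 2 of [g 0], so the point at parameter pi is ahead of
    [g 0] and, being also the point at -pi, behind it. *)
Lemma speed_lower_bound : 2 <= c * pi.
Proof.
rewrite leNgt; apply/negP => cpi; have pi_gt0 := pi_gt0 R.
have close t : enorm (g t - g 0) < 2.
  have [t' tt' t'0] := circle_eq_dist 0 t.
  rewrite (circle_injection_eq gi tt') (le_lt_trans (knot_lipschitz gvc _ _))//.
  by rewrite (le_lt_trans _ cpi)// ler_pM2l.
have f1 := @tangent_balls_forward 0 pi _ (fun _ _ => close _).
have f2 := @tangent_balls_forward 0 (- pi) _ (fun _ _ => close _).
have E : g (0 - pi) = g (0 + pi) by apply/gi; exists 1; rewrite mulr1; ring.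
move: f2 f1; rewrite E normrN gtr0_norm// pi_gt0 mulNr.
have -> : pi < 2 * pi :> R by lra.
by move=> /(_ isT) f2 /(_ isT) f1; lra.
Qed.

(** The tangent ball inequality bounds the cosine of the angle between chord and velocity by sqrt(1
    - |d|^2/4) >= 1 - |d|^2/4 from below; only the sign of the inner product has to be supplied. *)
Let chord_tangent s (d : 'E3[R]) : enorm d <= 1 -> d != 0 ->
  dot d d * c ^+ 2 - dot d (v s) ^+ 2 <= c ^+ 2 * dot d d ^+ 2 / 4 ->
  0 < dot d (v s) ->
  enorm (v s - (c / enorm d) *: d) <= c * enorm d.
Proof.
move=> d1 d0 tbd q0.
have dgt0 : 0 < enorm d by rewrite enorm_gt0.
have qge : c * enorm d * (1 - enorm d ^+ 2 / 4) <= dot d (v s).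
  rewrite -ler_sqr ?nnegrE ?(ltW q0)//; last first.
    have d21 : enorm d ^+ 2 <= 1 by rewrite expr_le1 ?enorm_ge0.
    by rewrite mulr_ge0 ?mulr_ge0 ?(ltW c0) ?enorm_ge0//; lra.
  rewrite -sqr_enorm in tbd; set x := enorm d in tbd d1 dgt0 *.
  set q := dot d (v s) in tbd q0 *; clearbody x q.
  have : 0 <= c ^+ 2 * x ^+ 2 * (x ^+ 2 / 4) * (1 - x ^+ 2 / 4).
    have x21 : x ^+ 2 <= 1 by rewrite expr_le1 ?(ltW dgt0).
    by rewrite !mulr_ge0 ?invr_ge0 ?(ltW c0) ?(ltW dgt0)//; lra.
  move: tbd; lra.
rewrite -ler_sqr ?nnegrE ?mulr_ge0 ?enorm_ge0 ?(ltW c0)// sqr_enorm dotBB.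
rewrite !(dotZl, dotZr) vv -sqr_enorm (dotC (v s)).
have -> : c / enorm d * (c / enorm d * enorm d ^+ 2) = c ^+ 2.
  by field; rewrite gt_eqF.
have : c / enorm d * (c * enorm d * (1 - enorm d ^+ 2 / 4)) <=
    c / enorm d * dot d (v s).
  by rewrite ler_wpM2l// divr_ge0 ?ltW.
have -> : c / enorm d * (c * enorm d * (1 - enorm d ^+ 2 / 4)) =
    c ^+ 2 * (1 - enorm d ^+ 2 / 4).
  by field; rewrite gt_eqF.
have : 0 <= (c * enorm d) ^+ 2 by exact: sqr_ge0.
rewrite exprMn; lra.
Qed.

Lemma velocity_lipschitz s t : enorm (v t - v s) <= 2 * c ^+ 2 * `|t - s|.
Proof.
have [->|ts] := eqVneq t s.
  by rewrite !subrr enorm0 normr0 mulr0.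
have ts0 : 0 < `|t - s| by rewrite normr_gt0 subr_eq0.
(* In the far case the trivial bound 2c is already at most 2c^2 |t - s|. *)
have [far|near] := leP 1 (c * `|t - s|).
  rewrite (le_trans (ler_enormD _ _))// enormN !vc.
  have : c * 1 <= c * (c * `|t - s|) by rewrite ler_pM2l.
  rewrite expr2; lra.
have pi_gt0 := pi_gt0 R.
have tspi : `|t - s| < 2 * pi.
  rewrite -(ltr_pM2l c0) (lt_trans near)//; have := speed_lower_bound; lra.
have close x y (a : R) : `|y - x| = `|t - s| -> 0 < a <= 1 ->
    enorm (g (x + a * (y - x)) - g x) < 2.
  move=> yx /andP[a0 a1]; rewrite (le_lt_trans (knot_lipschitz gvc _ _))//.
  rewrite addrAC subrr add0r normrM yx gtr0_norm//.
  have : c * (a * `|t - s|) <= c * `|t - s| by rewrite ler_pM2l// ler_piMl.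
  lra.
have fwd x y : `|y - x| = `|t - s| -> 0 < (y - x) * dot (g y - g x) (v x).
  move=> yx; have := @tangent_balls_forward x (y - x).
  rewrite yx ts0 tspi (addrC x) subrK => /(_ isT); apply.
  by move=> a; exact: close.
have f1 := fwd s t erefl; have f2 := fwd t s (distrC _ _).
(* The chord is oriented by increasing parameter, so that it makes an acute angle with both
   velocities and each lies within c|d| <= c^2 |t - s| of the same vector. *)
pose d := Num.sg (t - s) *: (g t - g s).
have sg1 : Num.sg (t - s) ^+ 2 = 1 by rewrite sqr_sg subr_eq0 ts.
have dd : dot d d = dot (g t - g s) (g t - g s).
  by rewrite /d dotZl dotZr mulrA -expr2 sg1 mul1r.
have ed : enorm d = enorm (g t - g s) by rewrite !enormE dd.
have d0 : d != 0.
  rewrite -enorm_gt0 ed enorm_gt0; apply: contraTN f1 => /eqP ->.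
  by rewrite dot0l mulr0 ltxx.
have dts : enorm d <= c * `|t - s| by rewrite ed; exact: knot_lipschitz gvc _ _.
have q1 : 0 < dot d (v s).
  by rewrite /d dotZl; move: f1; rewrite {1}[t - s]numEsg mulrAC pmulr_lgt0.
have q2 : 0 < dot d (v t).
  rewrite /d dotZl; move: f2.
  rewrite -(opprB t s) -(opprB (g t)) dotNl mulrNN {1}[t - s]numEsg.
  by rewrite mulrAC pmulr_lgt0.
have dv x : dot d (v x) ^+ 2 = dot (g t - g s) (v x) ^+ 2.
  by rewrite /d dotZl exprMn sg1 mul1r.
have /= tb1 := tb s t; have /= tb2 := tb t s.
rewrite -dd -dv in tb1.
rewrite -(opprB (g t)) !(dotNl, dotNr) opprK sqrrN -dd -dv in tb2.
have d1 : enorm d <= 1 by lra.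
have := chord_tangent d1 d0 tb1 q1; have := chord_tangent d1 d0 tb2 q2.
rewrite (enormBC (v s)) => b2 b1.
rewrite (le_trans (ler_enormB _ ((c / enorm d) *: d) _))//.
rewrite (le_trans (lerD b2 b1))//.
have : c * enorm d <= c * (c * `|t - s|) by rewrite ler_pM2l.
rewrite expr2; lra.
Qed.

(** Close to [s] the chord is at least (c/2)|t - s|, and c >= 2/pi turns this into the constant pi.
    Farther away the chord is at least 1/8 while |t - s| <= pi, which gives 8 pi. *)
Lemma chord_arc s t : `|t - s| <= pi -> `|t - s| <= 8 * pi * enorm (g t - g s).
Proof.
move=> tspi; have pi_gt0 := pi_gt0 R.
have c_neq0 : c != 0 by rewrite gt_eqF.
have cpi := speed_lower_bound.
have small t' : `|t' - s| <= (4 * c)^-1 -> c / 2 * `|t' - s| <= enorm (g t' - g s).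
  move=> ts; have tay := taylor1_enorm gv velocity_lipschitz s t'.
  have cd : c * `|t' - s| <= enorm (g t' - g s) + 2 * c ^+ 2 * (t' - s) ^+ 2.
    rewrite -{1}(vc s) mulrC -enormZ.
    have := ler_enormB ((t' - s) *: v s) (g t' - g s) 0.
    rewrite !subr0 enormBC; lra.
  have : 2 * c ^+ 2 * (t' - s) ^+ 2 <= c / 2 * `|t' - s|.
    rewrite -[(t' - s) ^+ 2]real_normK ?num_real//.
    have := ler_wpM2l (ltW c0) ts; have -> : c * (4 * c)^-1 = 1 / 4.
      by field.
    move=> cts; have : (c * `|t' - s|) * (c * `|t' - s|) <= c * `|t' - s| * (1 / 4).
      by rewrite ler_wpM2l// mulr_ge0 ?(ltW c0).
    by rewrite expr2; lra.
  lra.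
have [ts|ts] := leP `|t - s| (4 * c)^-1.
  have := small t ts.
  have : 2 * `|t - s| <= c * pi * `|t - s| by rewrite ler_wpM2r.
  set d := enorm _; have d0 : 0 <= d by exact: enorm_ge0.
  move=> le1 le2; have := ler_wpM2l (ltW pi_gt0) le2.
  have : 0 <= pi * d by rewrite mulr_ge0// ltW.
  lra.
suff : 1 / 8 <= enorm (g t - g s).
  by move=> le; have := ler_wpM2l (ltW pi_gt0) le; lra.
set e := (4 * c)^-1 in ts small *.
have e0 : 0 < e by rewrite invr_gt0 mulr_gt0.
have ce : c * e = 1 / 4 by rewrite /e; field.
have epi : e < pi.
  by rewrite -(ltr_pM2l c0) ce; lra.
have ab : s + e <= s + 2 * pi - e by lra.
pose f t := dot (g t - g s) (g t - g s).
have fd (x : R) : is_derive x 1 f (2 * dot (v x) (g x - g s)).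
  apply: is_derive_dot_sqr.
  by have := is_deriveB (gv x) (is_derive_cst (g s) x 1); rewrite subr0.
have fc : {within `[s + e, s + 2 * pi - e], continuous f}.
  by apply: continuous_subspaceT => x; exact: is_derive_continuous (fd x).
have [m] := EVT_min ab fc; rewrite in_itv/= => /andP[em me] fm.
have end1 (x : R) : `|x - s| = e -> 1 / 8 <= enorm (g x - g s).
  by move=> xs; have := small x; rewrite xs lexx => /(_ isT); lra.
have per x : g (x + 2 * pi) = g x.
  by apply/gi/circle_eq_sym; exists 1; rewrite mulr1.
(* At the ends of the interval the local bound gives (c/2)e = 1/8. An interior minimum is critical,
   so the chord is orthogonal to the velocity at [m] and has length at least 2. *)
have m8 : 1 / 8 <= enorm (g m - g s).
  have [->|m1] := eqVneq m (s + e).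
    by apply: end1; rewrite addrAC subrr add0r gtr0_norm.
  have [->|m2] := eqVneq m (s + 2 * pi - e).
    rewrite (_ : s + 2 * pi - e = s - e + 2 * pi); last by ring.
    by rewrite per; apply: end1; rewrite addrAC subrr add0r normrN gtr0_norm.
  have mitv : m \in `]s + e, s + 2 * pi - e[.
    by rewrite in_itv/= !lt_neqAle em me eq_sym m1 m2.
  have fm' : forall t, t \in `]s + e, s + 2 * pi - e[ -> f m <= f t.
    move=> x; rewrite in_itv/= => /andP[x1 x2]; apply: fm.
    by rewrite in_itv/= !ltW.
  have [_ f0] :=
    derive1_at_min ab (fun t _ => @ex_derive _ _ _ _ _ _ _ (fd t)) mitv fm'.
  have := @derive_val _ _ _ _ _ _ _ (fd m); rewrite f0 => /eqP.
  rewrite eq_sym mulf_eq0 pnatr_eq0/= dotC -(opprB (g s)) dotNl oppr_eq0 => /eqP o.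
  rewrite enormN (le_trans _ (tangent_balls_orthogonal _ o))//; first by lra.
  apply/eqP => /gi/circle_eq_near => ms.
  have {}ms : m = s by apply: ms; rewrite ltr_norml; apply/andP; split; lra.
  by move: em; rewrite ms gerDl leNgt e0.
rewrite (le_trans m8)// ler_enorm_sqr.
have [ge|lt] := lerP 0 (t - s).
  rewrite ger0_norm// in ts tspi; apply: fm; rewrite in_itv/=.
  by apply/andP; split; lra.
rewrite ltr0_norm// in ts tspi.
have := fm (t + 2 * pi); rewrite /f per; apply; rewrite in_itv/=.
by apply/andP; split; lra.
Qed.

End UniformEstimates.

(** * Translation between configurations and the analytic conditions *)

Section Configurations.
Variable R : realType.
Implicit Types (s t c Lam : R) (g v : R -> 'E3[R]) (K : set (set 'E3[R])).

Lemma curve_length_constant_speed g c :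
  (forall t, enorm (derive1 g t) = c) -> curve_length g = 2 * pi * c.
Proof.
move=> gc; rewrite /curve_length; under eq_Rintegral do rewrite gc.
rewrite Rintegral_cst; last exact: measurable_itv.
by rewrite /= lebesgue_measure_itv/= lte_fin pi2_gt0/= subr0 mulrC.
Qed.

Lemma configuration_knot K Lam g : configuration K Lam g ->
  exists c, [/\ constant_speed_knot g (derive1 g) c,
    tangent_balls g (derive1 g) c, K (range g) & 2 * pi * c <= Lam].
Proof.
move=> [[gi gd gc g0 gl] [c cE] Kg thick len].
have c0 : 0 < c by rewrite -(cE 0) enorm_gt0.
have gvc : constant_speed_knot g (derive1 g) c.
  by split=> // t; exact: is_derive_derive1.
exists c; split=> //; last by rewrite -(curve_length_constant_speed cE).
(* The Lipschitz condition holds for every constant beyond [M], so [M + 1] is taken; the factor 2c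
   below rescales the unit tangent to the velocity and the sup norm to the Euclidean one. *)
have [M [_ ML]] := gl; have {ML} := ML (M + 1); rewrite ltrDl => /(_ ltr01) L.
apply: (thick_tangent_balls (M := 2 * c * (M + 1))) gvc _ _; last exact/reach_ge1P.
move=> s t; have := L (t, s) (conj I I) => /=.
rewrite /unit_tangent !cE -scalerBr normrZ normfV (gtr0_norm c0).
rewrite ler_pdivrMl// => le; rewrite (le_trans (enorm_le_normr _))//.
by rewrite -!mulrA ler_pM2l.
Qed.

Lemma knot_configuration K Lam g v c : constant_speed_knot g v c ->
  tangent_balls g v c -> K (range g) -> 2 * pi * c <= Lam ->
  configuration K Lam g.
Proof.
move=> gvc tb Kg len; have [gi gv vcont c0 vc] := gvc.
have vE : derive1 g = v by apply/funext => t; exact: derive1_val.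
split=> //; first split=> //; rewrite ?vE//.
- by move=> t; rewrite -enorm_gt0 vc.
- apply: (@klipschitzW _ _ _ (2 * c)).
    exact: (@globally_properfilter _ _ (0, 0)).
  move=> [t s] _ /=; rewrite /unit_tangent vE !vc -scalerBr normrZ normfV.
  rewrite (gtr0_norm c0) ler_pdivrMl// (le_trans (normr_le_enorm _))//.
  rewrite (le_trans (velocity_lipschitz gvc tb _ _))// expr2 !mulrA.
  by rewrite (mulrC c 2).
- by exists c => t; rewrite vE.
- by apply/reach_ge1P; exact: tangent_balls_thick gvc tb.
- by rewrite (@curve_length_constant_speed _ c)// => t; rewrite vE.
Qed.

End Configurations.

(** Gives ['E3[R]] the completeness required by the Banach fixed point theorem. *)
HB.instance Definition _ (R : realType) m n := Complete.on 'M[R]_(m.+1, n.+1).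

(** * Ambient isotopies from small Lipschitz displacements *)

Section Isotopy.
Variable R : realType.
Implicit Types (k : set 'E3[R]) (x y : 'E3[R]).

Lemma lipschitz_continuous (V W : normedModType R) (f : V -> W) (L : R) :
  (forall x y : V, `|f x - f y| <= L * `|x - y|) -> continuous f.
Proof.
move=> fL x; apply/(@cvgrPdist_le _ _ _ (nbhs x) _) => e e0.
have L0 : 0 < `|L| + 1 by rewrite ltr_wpDl.
near=> y; rewrite (le_trans (fL _ _))//.
rewrite (@le_trans _ _ ((`|L| + 1) * `|x - y|))//.
  by rewrite ler_wpM2r// (le_trans (ler_norm L))// lerDl.
rewrite mulrC -ler_pdivlMr//; near: y.
by apply: cvgr_dist_le; [exact: cvg_id|rewrite divr_gt0].
Unshelve. all: by end_near. Qed.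

Lemma continuousT_comp (T U V : topologicalType) (f : T -> U) (h : U -> V) :
  continuous f -> continuous h -> continuous (h \o f).
Proof. by move=> fc hc x; apply: continuous_comp; [exact: fc|exact: hc]. Qed.

(** The two isotopies run simultaneously, by composing them at each time, instead of one after the
    other; this leaves no gluing in the time variable. *)
Lemma ambient_isotopic_trans (k1 k2 k3 : set 'E3[R]) :
  ambient_isotopic k1 k2 -> ambient_isotopic k2 k3 -> ambient_isotopic k1 k3.
Proof.
move=> [H [Hc Hh H0 H1]] [G [Gc Gh G0 G1]].
exists (fun p => G (p.1, H p)); split.
- pose h p := (p.1, H p); apply/subspace_continuousP => q q01.
  have hc : h @ within (`[0, 1] `*` setT) (nbhs q) --> h q.
    have h1 : fst @ within (`[0, 1] `*` setT) (nbhs q) --> q.1.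
      by apply: cvg_within_filter; exact: cvg_fst.
    have h2 : H @ within (`[0, 1] `*` setT) (nbhs q) --> H q.
      by move/subspace_continuousP: Hc; exact.
    exact: (cvg_pair h1 h2).
  have q01' : (`[0, 1] `*` setT) (h q) by case: q01.
  move/subspace_continuousP: Gc => /(_ _ q01') Gc.
  apply: (cvg_comp h G _ Gc) => P; rewrite /within/= => /hc.
  rewrite /within/= /nbhs/= => PB; apply: filterS PB => r PB r01.
  by apply: PB => //; case: r01.
- move=> t t01; have [Htc [H' [H'c HK KH]]] := Hh t t01.
  have [Gtc [G' [G'c GK KG]]] := Gh t t01.
  split; first exact: (continuousT_comp Htc Gtc).
  exists (H' \o G'); split.
  + exact: (continuousT_comp G'c H'c).
  + by move=> x /=; rewrite GK HK.
  + by move=> x /=; rewrite KH KG.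
- by move=> x /=; rewrite H0 G0.
- by rewrite -G1 -H1 image_comp.
Qed.

(** The extension is the infimum of the upward cones of slope [L] with apex on the graph of [f]. *)
Lemma mcshane_extension (A : set 'E3[R]) (f : 'E3[R] -> R) (L : R) :
  A !=set0 -> 0 <= L ->
  (forall a b, A a -> A b -> `|f a - f b| <= L * `|a - b|) ->
  exists2 F : 'E3[R] -> R, forall a, A a -> F a = f a &
    forall x y, `|F x - F y| <= L * `|x - y|.
Proof.
move=> [a0 Aa0] L0 fL.
pose S x := [set f a + L * `|x - a| | a in A].
have lbS x a : A a -> f a0 - L * `|x - a0| <= f a + L * `|x - a|.
  move=> Aa; have := fL _ _ Aa0 Aa; rewrite ler_norml => /andP[_ le].
  have : L * `|a0 - a| <= L * (`|x - a0| + `|x - a|).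
    by rewrite ler_wpM2l// (distrC x a0) ler_distD.
  lra.
have lb x : has_lbound (S x).
  by exists (f a0 - L * `|x - a0|) => _ [a Aa <-]; exact: lbS.
have infS x : has_inf (S x).
  by split=> //; exists (f a0 + L * `|x - a0|), a0.
have Fle x y : inf (S x) <= inf (S y) + L * `|x - y|.
  rewrite -lerBlDr; apply: lb_le_inf; first by case: (infS y).
  move=> _ [a Aa <-]; rewrite lerBlDr.
  apply: (@le_trans _ _ (f a + L * `|x - a|)).
    by apply: ge_inf => //; exists a.
  by rewrite -addrA lerD2l -mulrDr ler_wpM2l// (addrC `|y - a|) ler_distD.
exists (fun x => inf (S x)) => [a Aa|x y].
  apply/eqP; rewrite eq_le; apply/andP; split.
    by apply: ge_inf => //; exists a => //; rewrite subrr normr0 mulr0 addr0.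
  apply: lb_le_inf; first by case: (infS a).
  move=> _ [b Ab <-]; have := fL _ _ Aa Ab; rewrite ler_norml => /andP[_]; lra.
rewrite ler_norml; have := Fle x y; have := Fle y x; rewrite (distrC y x); lra.
Qed.

(* The inverse is the fixed point of the contraction x |-> y - p x. *)
Lemma perturbation_homeomorphism (p : 'E3[R] -> 'E3[R]) :
  (forall x y, `|p x - p y| <= 2^-1 * `|x - y|) ->
  homeomorphism (fun x => x + p x).
Proof.
move=> pL; split.
  move=> x; apply: (@cvgD _ _ _ (nbhs x) _ id p); first exact: cvg_id.
  exact: (lipschitz_continuous pL).
have surj y : exists x, x + p x = y.
  pose f x := y - p x.
  have fT : {homo f : x / [set: 'E3[R]] x} by [].
  have fixf : is_contraction (mkfun fT).
    exists (2^-1)%:nng; split; first by rewrite /= invf_lt1// ltr1n.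
    by move=> [x z] _ /=; rewrite /f opprB addrC addrA subrK (distrC (p z)) pL.
  have [|x _ E] := banach_fixed_point fixf closedT; first by exists 0.
  by exists x; rewrite [X in X + _]E subrK.
have [q qE] := choice surj.
(* The map shrinks distances at most by half, so its inverse is single-valued and 2-Lipschitz. *)
have expand x y : `|x - y| <= 2 * `|(x + p x) - (y + p y)|.
  have := ler_normB ((x + p x) - (y + p y)) (p x - p y).
  rewrite (_ : x + p x - (y + p y) - (p x - p y) = x - y).
    by have := pL x y; lra.
  by apply/rowP => i; rewrite !mxE; ring.
exists q; split.
- apply: (@lipschitz_continuous _ _ _ 2) => x y.
  by have := expand (q x) (q y); rewrite !qE.
- move=> x; apply/eqP; rewrite -subr_eq0 -normr_le0.
  by have := expand (q (x + p x)) x; rewrite qE subrr normr0 mulr0.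
- by move=> y; exact: qE.
Qed.

Lemma perturbation_isotopic (p : 'E3[R] -> 'E3[R]) k :
  (forall x y, `|p x - p y| <= 2^-1 * `|x - y|) ->
  ambient_isotopic k ((fun x => x + p x) @` k).
Proof.
move=> pL; exists (fun q : R * 'E3[R] => q.2 + q.1 *: p q.2); split.
- apply: continuous_subspaceT => q.
  apply: (@cvgD _ _ _ (nbhs q) _ snd); first exact: cvg_snd.
  apply: (@cvgZ _ _ _ (nbhs q) _ fst); first exact: cvg_fst.
  apply: (@continuous_comp _ _ _ snd p); first exact: cvg_snd.
  exact: lipschitz_continuous pL _.
- move=> t; rewrite in_itv/= => /andP[t0 t1].
  apply: perturbation_homeomorphism => x y.
  rewrite -scalerBr normrZ ger0_norm// (le_trans _ (pL x y))//.
  by rewrite ler_piMl.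
- by move=> x /=; rewrite scale0r addr0.
- by apply: eq_imagel => x _ /=; rewrite scale1r.
Qed.

(** The displacement between the curves is 1/(32 pi)-Lipschitz in the parameter, hence by chord-arc
    1/4-Lipschitz in Euclidean distance along [g], hence 1/2-Lipschitz in the sup norm. Extending
    each coordinate separately preserves a sup norm constant. *)
Lemma C1_close_isotopic (g v g2 v2 : R -> 'E3[R]) (c : R) :
  constant_speed_knot g v c -> tangent_balls g v c ->
  circle_injection g2 -> (forall t : R, is_derive t 1 g2 (v2 t)) ->
  (forall t, 32 * pi * enorm (v2 t - v t) <= 1) ->
  ambient_isotopic (range g) (range g2).
Proof.
move=> gvc tb gi2 gv2 v2v; have [gi gv _ _ _] := gvc; have pi_gt0 := pi_gt0 R.
have pi32 : 0 < 32 * pi :> R by rewrite mulr_gt0.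
have d_lip s t : enorm ((g2 t - g t) - (g2 s - g s)) <= (32 * pi)^-1 * `|t - s|.
  apply: (@mean_value_enorm_sym _ (fun t => g2 t - g t) (fun t => v2 t - v t)).
  by move=> x; rewrite -[leRHS]mulr1 ler_pdivlMl.
have /choice[q qE] (x : 'E3[R]) : exists t, range g x -> g t = x.
  by have [[t _ <-]|] := pselect (range g x); [exists t|exists 0].
pose phi x := g2 (q x) - g (q x).
have gq t : circle_eq (q (g t)) t by apply/gi/qE; exists t.
have phiE t : phi (g t) = g2 t - g t.
  by rewrite /phi (circle_injection_eq gi (gq t)) (circle_injection_eq gi2 (gq t)).
have phi_lip x y : range g x -> range g y -> `|phi x - phi y| <= 2^-1 * `|x - y|.
  move=> [t _ <-] [s _ <-].
  have [t' tt' t's] := circle_eq_dist s t.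
  rewrite (circle_injection_eq gi tt') !phiE (le_trans (normr_le_enorm _))//.
  rewrite (le_trans (d_lip _ _))// ler_pdivrMl//.
  rewrite (le_trans (chord_arc gvc tb t's))//.
  have := enorm_le_normr (g t' - g s) => le.
  have := ler_wpM2l (ltW pi_gt0) le; lra.
have g0 : range g !=set0 by exists (g 0), 0.
have /choice[F FP] (i : 'I_3) : exists F : 'E3[R] -> R,
    (forall a, range g a -> F a = phi a 0 i) /\
    (forall x y, `|F x - F y| <= 2^-1 * `|x - y|).
  have [|a b ga gb|F FE FL] := @mcshane_extension (range g)
    (fun x => phi x 0 i) 2^-1 g0; last by exists F.
    by rewrite invr_ge0.
  by rewrite (le_trans _ (phi_lip a b ga gb))//
    (le_trans _ (normr_coord (phi a - phi b) i))// !mxE.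
pose p x : 'E3[R] := \row_i F i x.
have -> : range g2 = (fun x => x + p x) @` range g.
  have pg t : g t + p (g t) = g2 t.
    have -> : p (g t) = g2 t - g t; last by rewrite addrC subrK.
    by rewrite -phiE; apply/rowP => i; rewrite mxE; case: (FP i) => -> //; exists t.
  apply/seteqP; split=> [_ [t _ <-]|_ [_ [t _ <-] <-]].
    by exists (g t); rewrite ?pg//; exists t.
  by exists t; rewrite ?pg.
apply: perturbation_isotopic => x y.
rewrite [leLHS]/Num.norm/= mx_normrE; apply: bigmax_le => [|[i j] _ /=].
  by rewrite mulr_ge0// invr_ge0.
by rewrite !mxE; case: (FP j).
Qed.

End Isotopy.

(** * Limits of thick curves along an ultrafilter *)

Section UltraLimits.
Variables (R : realType) (T : Type) (F : set_system T).
Hypothesis UF : UltraFilter F.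

Let PF : ProperFilter F. Proof. exact: ultra_proper. Qed.
Let FF : Filter F. Proof. exact: filter_filter. Qed.

Lemma ultra_compact_cvg (U : topologicalType) (A : set U) (f : T -> U) :
  compact A -> (forall q, A (f q)) -> exists2 l, A l & f @ F --> l.
Proof.
move=> cA Af; have FA : (f @ F) A := @filterE _ F FF (f @^-1` A) Af.
have [l [Al cl]] := cA _ (fmap_proper_filter f PF) FA; exists l => // B lB.
have [//|nB] := in_ultra_setVsetC (f @^-1` B) UF.
have nB' : (f @ F) (~` B) by exact: nB.
by have [x []] := cl _ _ nB' lB.
Qed.

Let ler_ultra (f h : T -> R) (a b : R) : f @ F --> a -> h @ F --> b ->
  (forall q, f q <= h q) -> a <= b.
Proof.
move=> fa hb fh; rewrite -subr_ge0.
apply: (@closed_cvg _ _ F PF (fun q => h q - f q) _ (@closed_ge R 0)).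
  by apply: (@filterE _ F FF) => q /=; rewrite subr_ge0.
exact: cvgB.
Qed.

Lemma ultra_bounded_cvg (f : T -> 'E3[R]) (M : R) :
  (forall q, enorm (f q) <= M) -> exists l : 'E3[R], f @ F --> l.
Proof.
move=> fM; have [|l _ fl] := ultra_compact_cvg (f := f) (@compact_eball R 0 M).
  by move=> q /=; rewrite subr0.
by exists l.
Qed.

Lemma ultra_uniform (f : T -> R -> 'E3[R]) (l : R -> 'E3[R]) (B : R) :
  (forall q s t, enorm (f q t - f q s) <= B * `|t - s|) ->
  (forall s t, enorm (l t - l s) <= B * `|t - s|) ->
  (forall q s t, circle_eq s t -> f q s = f q t) ->
  (forall s t, circle_eq s t -> l s = l t) ->
  (forall t, (fun q => f q t) @ F --> l t) ->
  forall e, 0 < e -> \forall q \near F, forall t, enorm (f q t - l t) <= e.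
Proof.
move=> fB lB fp lp fl e e0.
have [//|bad] := in_ultra_setVsetC [set q | forall t, enorm (f q t - l t) <= e] UF.
have B0 : 0 <= B.
  by have := le_trans (enorm_ge0 _) (lB 0 1); rewrite subr0 normr1 mulr1.
have B1 : 0 < B + 1 by rewrite ltr_wpDl.
(* [tau q] is a parameter where the bound fails, if there is one, moved into a compact period so
   that it converges along [F]. At its limit the error is at most e/4, and moving back to [tau q]
   costs at most e/4 for each of the two curves. *)
have /choice[tau tauP] (q : T) : exists t : R, 0 <= t <= 2 * pi /\
    ((exists t, e < enorm (f q t - l t)) -> e < enorm (f q t - l t)).
  have [[t et]|no] := pselect (exists t, e < enorm (f q t - l t)); last first.
    by exists 0; rewrite lexx ltW// pi2_gt0.
  have [t' tt' /andP[t0 t1]] := circle_eq_in 0 t.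
  have t2 : t' <= 2 * pi by lra.
  exists t'; rewrite t0 t2; split=> // _.
  by rewrite -(fp _ _ _ tt') -(lp _ _ tt').
have [|t _ taut] := @ultra_compact_cvg _ _ tau (@segment_compact R 0 (2 * pi)).
  by move=> q /=; rewrite in_itv/=; case: (tauP q).
have e4 : 0 < e / 4 by rewrite divr_gt0.
have eB : 0 < e / (4 * (B + 1)) by rewrite divr_gt0// mulr_gt0.
have close : \forall q \near F, enorm (f q t - l t) <= e / 4.
  have : (fun q => enorm (f q t - l t)) @ F --> enorm (l t - l t).
    by apply: cvg_enorm; apply: cvgB (fl t) _; exact: cvg_cst.
  rewrite subrr enorm0 => /cvgrPdist_le/(_ _ e4); apply: filterS => q.
  by rewrite sub0r normrN ger0_norm// enorm_ge0.
have near_t : \forall q \near F, `|t - tau q| <= e / (4 * (B + 1)).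
  by move/cvgrPdist_le: taut; exact.
exfalso; apply: (@filter_not_empty _ F PF).
apply: filterS (filterI bad (filterI close near_t)) => q [/= qbad [c1 c2]].
have [_ /(_ _)tq] := tauP q.
have {tq} : e < enorm (f q (tau q) - l (tau q)).
  apply: tq; apply: contrapT => no; apply: qbad => s.
  by rewrite leNgt; apply/negP => es; apply: no; exists s.
have Bt : B * `|t - tau q| <= e / 4.
  rewrite (le_trans (ler_wpM2l B0 c2))//.
  rewrite (_ : B * _ = e / 4 * (B / (B + 1))); last first.
    by field; rewrite gt_eqF.
  by rewrite ler_piMr ?(ltW e4)// ler_pdivrMr// mul1r lerDl.
have f1 := fB q t (tau q); rewrite distrC in f1.
have l1 := lB (tau q) t.
have t1 := ler_enormB (f q (tau q)) (f q t) (l (tau q)).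
have t2 := ler_enormB (f q t) (l t) (l (tau q)).
lra.
Qed.

Variables (g v : T -> R -> 'E3[R]) (c : T -> R) (M : R).
Hypotheses (gvc : forall q, constant_speed_knot (g q) (v q) (c q))
  (tb : forall q, tangent_balls (g q) (v q) (c q))
  (g0 : forall q, g q 0 = 0) (cM : forall q, c q <= M).

Lemma ultra_limit_knot : exists g' v' c', [/\ constant_speed_knot g' v' c',
  tangent_balls g' v' c', c' <= M,
  (forall t, (fun q => g q t) @ F --> g' t) &
  (forall t, (fun q => v q t) @ F --> v' t)].
Proof.
have pi_gt0 := pi_gt0 R.
have c_ge0 q : 0 <= c q by case: (gvc q) => _ _ _ /ltW.
have vE q t : enorm (v q t) = c q by case: (gvc q).
have /choice[g' gg'] (t : R) : exists l : 'E3[R], (fun q => g q t) @ F --> l.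
  apply: (@ultra_bounded_cvg _ (M * `|t|)) => q.
  have := knot_lipschitz (gvc q) 0 t; rewrite g0 !subr0 => /le_trans; apply.
  by rewrite ler_wpM2r.
have /choice[v' vv'] (t : R) : exists l : 'E3[R], (fun q => v q t) @ F --> l.
  by apply: (@ultra_bounded_cvg _ M) => q; rewrite vE.
(* The compact range [2/pi, M] keeps the limit speed positive. *)
have [|c' /=] := @ultra_compact_cvg _ _ c (@segment_compact R (2 / pi) M).
  move=> q /=; rewrite in_itv/= cM andbT ler_pdivrMr//.
  exact: speed_lower_bound (gvc q) (tb q).
rewrite in_itv/= => /andP[c'_ge c'M] cc'.
have c'0 : 0 < c' by rewrite (lt_le_trans _ c'_ge)// divr_gt0.
have c2 : (fun q => 2 * c q ^+ 2) @ F --> 2 * c' ^+ 2.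
  by apply: cvgM; [exact: cvg_cst|under eq_fun do rewrite expr2; exact: cvgM].
have dg s t : (fun q => g q t - g q s) @ F --> g' t - g' s by exact: cvgB.
have v'c t : enorm (v' t) = c'.
  have e1 : (fun q => enorm (v q t)) @ F --> enorm (v' t) by exact: cvg_enorm.
  have e2 : (fun q => enorm (v q t)) @ F --> c'.
    by under eq_fun do rewrite vE.
  exact: (cvg_unique _ e1 e2).
have tay s t : enorm (g' t - g' s - (t - s) *: v' s) <= 2 * c' ^+ 2 * (t - s) ^+ 2.
  have L : (fun q => enorm (g q t - g q s - (t - s) *: v q s)) @ F -->
      enorm (g' t - g' s - (t - s) *: v' s).
    apply: cvg_enorm; apply: cvgB; first exact: dg.
    by apply: cvgZ; [exact: cvg_cst|exact: vv'].
  have H : (fun q => 2 * c q ^+ 2 * (t - s) ^+ 2) @ F -->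
      2 * c' ^+ 2 * (t - s) ^+ 2 by apply: cvgM; [exact: c2|exact: cvg_cst].
  apply: (ler_ultra L H) => q; apply: taylor1_enorm.
    by case: (gvc q).
  exact: velocity_lipschitz (gvc q) (tb q).
have v'L s t : enorm (v' t - v' s) <= 2 * c' ^+ 2 * `|t - s|.
  have L : (fun q => enorm (v q t - v q s)) @ F --> enorm (v' t - v' s).
    by apply: cvg_enorm; exact: cvgB.
  have H : (fun q => 2 * c q ^+ 2 * `|t - s|) @ F --> 2 * c' ^+ 2 * `|t - s|.
    by apply: cvgM; [exact: c2|exact: cvg_cst].
  apply: (ler_ultra L H) => q.
  exact: velocity_lipschitz (gvc q) (tb q) _ _.
(* A pointwise limit of injective curves may cross itself; the chord-arc inequality passes to the
   limit and prevents this. *)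
have chord s t : `|t - s| <= pi -> `|t - s| <= 8 * pi * enorm (g' t - g' s).
  move=> ts.
  have H : (fun q => 8 * pi * enorm (g q t - g q s)) @ F -->
      8 * pi * enorm (g' t - g' s).
    by apply: cvgM; [exact: cvg_cst|exact: cvg_enorm].
  apply: (ler_ultra (cvg_cst `|t - s|) H) => q.
  exact: chord_arc (gvc q) (tb q) _ _ ts.
have g'p s t : circle_eq s t -> g' s = g' t.
  move=> st; have E : (fun q => g q s) = (fun q => g q t).
    apply/funext => q.
    by case: (gvc q) => gi _ _ _ _; exact: circle_injection_eq gi st.
  by have gs := gg' s; rewrite E in gs; exact: (cvg_unique _ gs (gg' t)).
exists g', v', c'; split=> //; last first.
  move=> s t /=.
  have d2 : (fun q => dot (g q t - g q s) (g q t - g q s)) @ F -->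
    dot (g' t - g' s) (g' t - g' s) by exact: cvg_dot.
  have dv : (fun q => dot (g q t - g q s) (v q s)) @ F -->
    dot (g' t - g' s) (v' s) by exact: cvg_dot.
  have sqr (f : T -> R) (a : R) : f @ F --> a -> (fun q => f q ^+ 2) @ F --> a ^+ 2.
    by move=> fa; rewrite expr2; under eq_fun do rewrite expr2; exact: cvgM.
  have L : (fun q => dot (g q t - g q s) (g q t - g q s) * c q ^+ 2 -
      dot (g q t - g q s) (v q s) ^+ 2) @ F -->
      dot (g' t - g' s) (g' t - g' s) * c' ^+ 2 - dot (g' t - g' s) (v' s) ^+ 2.
    by apply: cvgB; [apply: cvgM d2 (sqr _ _ cc')|exact: sqr].
  have H : (fun q => c q ^+ 2 * dot (g q t - g q s) (g q t - g q s) ^+ 2 / 4)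
      @ F --> c' ^+ 2 * dot (g' t - g' s) (g' t - g' s) ^+ 2 / 4.
    by apply: cvgM; [apply: cvgM; exact: sqr|exact: cvg_cst].
  by apply: (ler_ultra L H) => q; exact: tb.
split=> //.
- move=> s t; split=> [st|]; last exact: g'p.
  have [t' tt' ts] := circle_eq_dist s t.
  have := chord s t' ts; rewrite -(g'p _ _ tt') -st subrr enorm0 mulr0.
  by rewrite normr_le0 subr_eq0 => /eqP <-; exact: circle_eq_sym.
- by move=> t; apply: is_derive_quadratic (tay t).
- apply: (@lipschitz_continuous _ _ _ _ (2 * c' ^+ 2 * 2)) => s t.
  rewrite (le_trans (normr_le_enorm _))// (le_trans (v'L _ _))//.
  by rewrite ler_wpM2r// ler_peMr ?ler1n// mulr_ge0// sqr_ge0.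
Qed.

End UltraLimits.

(** * Closedness of the relation of having the same shape *)

Section Isometries.
Variable R : realType.
Implicit Types (A : 'M[R]_3) (x y b : 'E3[R]) (a g : R -> 'E3[R]).

Lemma dot_mulmx A x y : A *m A^T = 1%:M -> dot (x *m A) (y *m A) = dot x y.
Proof.
have dotmx u w : dot u w = (u *m w^T) 0 0.
  by rewrite mxE; apply: eq_bigr => i _; rewrite mxE.
by move=> AA; rewrite !dotmx trmx_mul mulmxA -(mulmxA x) AA mulmx1.
Qed.

Lemma proper_isometry_enorm f x y :
  proper_isometry f -> enorm (f x - f y) = enorm (x - y).
Proof.
move=> [A [b [AA _ fE]]]; rewrite !fE (_ : _ - _ = (x - y) *m A).
  by rewrite !enormE dot_mulmx.
by rewrite mulmxBl opprD addrACA subrr addr0.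
Qed.

Lemma orthogonal_coord_le1 A i j : A *m A^T = 1%:M -> `|A i j| <= 1.
Proof.
move=> AA; have -> : A i j = row i A 0 j by rewrite mxE.
rewrite (le_trans (normr_coord_le _ _))// enormE.
have -> : dot (row i A) (row i A) = (A *m A^T) i i.
  by rewrite mxE; apply: eq_bigr => k _; rewrite !mxE.
by rewrite AA mxE eqxx sqrtr1.
Qed.

Section Limits.
Variables (T : Type) (F : set_system T).
Hypothesis FF : Filter F.

Lemma cvg_big_prod (I : Type) (r : seq I) (f : I -> T -> R) (l : I -> R) :
  (forall i, f i @ F --> l i) ->
  (fun q => \prod_(i <- r) f i q) @ F --> \prod_(i <- r) l i.
Proof.
move=> fl; elim: r => [|i r IH].
  by rewrite big_nil; under eq_fun do rewrite big_nil; exact: cvg_cst.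
by rewrite big_cons; under eq_fun do rewrite big_cons; exact: cvgM.
Qed.

Lemma cvg_big_sum (I : Type) (r : seq I) (f : I -> T -> R) (l : I -> R) :
  (forall i, f i @ F --> l i) ->
  (fun q => \sum_(i <- r) f i q) @ F --> \sum_(i <- r) l i.
Proof.
move=> fl; elim: r => [|i r IH].
  by rewrite big_nil; under eq_fun do rewrite big_nil; exact: cvg_cst.
by rewrite big_cons; under eq_fun do rewrite big_cons; exact: cvgD.
Qed.

Lemma cvg_det n (B : T -> 'M[R]_n) (B' : 'M[R]_n) :
  (forall i j, (fun q => B q i j) @ F --> B' i j) ->
  (fun q => \det (B q)) @ F --> \det B'.
Proof.
move=> BB'; apply: cvg_big_sum => s; apply: cvgM; first exact: cvg_cst.
by apply: cvg_big_prod => i; exact: BB'.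
Qed.

Lemma cvg_mulmx_coord m n p (B : T -> 'M[R]_(m, n)) (B' : 'M[R]_(m, n))
    (C : T -> 'M[R]_(n, p)) (C' : 'M[R]_(n, p)) i j :
  (forall i j, (fun q => B q i j) @ F --> B' i j) ->
  (forall i j, (fun q => C q i j) @ F --> C' i j) ->
  (fun q => (B q *m C q) i j) @ F --> (B' *m C') i j.
Proof.
move=> BB' CC'; rewrite mxE; under eq_fun do rewrite mxE.
by apply: cvg_big_sum => k; apply: cvgM; [exact: BB'|exact: CC'].
Qed.

Lemma cvg_coord (f : T -> 'E3[R]) x i :
  f @ F --> x -> (fun q => f q 0 i) @ F --> x 0 i.
Proof.
by move=> fx; exact: (cvg_comp _ _ fx (@coord_continuous R 1 3 0 i x)).
Qed.

End Limits.

(* The orthogonal group and the circle are compact, and the translation part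
   is determined by the image of one point. *)
Lemma same_shape_closed a (b : R -> 'E3[R]) : continuous a ->
  (forall s t, circle_eq s t -> a s = a t) ->
  (forall e, 0 < e ->
    exists2 g, same_shape a g & forall t, enorm (g t - b t) <= e) ->
  same_shape a b.
Proof.
move=> ac ap close.
(* The sign enters through its square and the shift is reduced to one period, so that rotation, sign
   and shift range over compact sets cut out by closed equations. *)
have data (n : nat) : exists p : 'M[R]_3 * 'E3[R] * R * R,
    [/\ p.1.1.1 *m p.1.1.1^T = 1%:M, \det p.1.1.1 = 1,
      p.1.2 ^+ 2 = 1, 0 <= p.2 <= 2 * pi &
      forall t, enorm (a (p.1.2 * t + p.2) *m p.1.1.1 + p.1.1.2 - b t) <=
        n.+1%:R^-1].
  have n0 : 0 < n.+1%:R^-1 :> R by rewrite invr_gt0.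
  have [g [f [h [[A [x [AA dA fE]]] [e [s [es hE]]] ->]]] gb] := close _ n0.
  have [s' ss' /andP[s0 s1]] := circle_eq_in 0 s.
  exists (A, x, e, s'); split=> //=.
  - by case: es => ->; rewrite ?sqrrN expr1n.
  - by rewrite s0 ltW// -[ltRHS]add0r.
  - move=> t; have := gb t; rewrite /= fE hE.
    suff -> : a (e * t + s) = a (e * t + s') by [].
    by apply: ap; case: ss' => k ->; exists k; rewrite addrA.
have {data close} [p pP] := choice data.
have [F [UF F_oo]] := ultraFilterLemma (@eventually_filter).
have PF : ProperFilter F by exact: ultra_proper.
have FF : Filter F by exact: filter_filter.
have small : (fun n : nat => n.+1%:R^-1 : R) @ F --> (0 : R).
  by apply: cvg_trans (@cvg_harmonic R); exact: cvg_fmap2.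
have /choice[A' AA'] (ij : 'I_3 * 'I_3) :
    exists l : R, (fun n => (p n).1.1.1 ij.1 ij.2) @ F --> l.
  have [|l _ lP] := @ultra_compact_cvg _ _ UF _ _
    (fun n => (p n).1.1.1 ij.1 ij.2) (@segment_compact R (-1) 1); last by exists l.
  move=> n /=; rewrite in_itv/= -ler_norml; apply: orthogonal_coord_le1.
  by case: (pP n).
pose A : 'M[R]_3 := \matrix_(i, j) A' (i, j).
have pA i j : (fun n => (p n).1.1.1 i j) @ F --> A i j.
  by rewrite mxE; exact: AA'.
have [|e _ ee] := @ultra_compact_cvg _ _ UF _ _
    (fun n => (p n).1.2) (@segment_compact R (-1) 1).
  move=> n /=; rewrite in_itv/= -ler_norml; have [_ _ e2 _ _] := pP n.
  by rewrite -(@expr_le1 _ 2)// real_normK ?num_real// e2.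
have [|s _ ss] := @ultra_compact_cvg _ _ UF _ _
    (fun n => (p n).2) (@segment_compact R 0 (2 * pi)).
  by move=> n /=; rewrite in_itv/=; case: (pP n).
have ah t : (fun n => a ((p n).1.2 * t + (p n).2)) @ F --> a (e * t + s).
  apply: continuous_cvg; first exact: ac.
  by apply: cvgD => //; apply: cvgM => //; exact: cvg_cst.
have ahA t i : (fun n => (a ((p n).1.2 * t + (p n).2) *m (p n).1.1.1) 0 i) @ F
    --> (a (e * t + s) *m A) 0 i.
  by apply: cvg_mulmx_coord => // i' j; rewrite (ord1 i'); exact: cvg_coord.
have img t i : (fun n => (a ((p n).1.2 * t + (p n).2) *m (p n).1.1.1 +
    (p n).1.1.2) 0 i) @ F --> b t 0 i.
  apply/cvgrPdist_le => eps eps0; move/cvgrPdist_le: small => /(_ _ eps0).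
  apply: filterS => n; rewrite sub0r normrN ger0_norm ?invr_ge0// => nle.
  rewrite (le_trans _ nle)//; have [_ _ _ _ /(_ t)] := pP n; apply: le_trans.
  by rewrite distrC (le_trans _ (normr_coord_le _ i))// !mxE.
(* The value at parameter 0 determines the limit translation. *)
pose x := b 0 - a (e * 0 + s) *m A.
have px i : (fun n => (p n).1.1.2 0 i) @ F --> x 0 i.
  have -> : (fun n => (p n).1.1.2 0 i) = (fun n =>
    (a ((p n).1.2 * 0 + (p n).2) *m (p n).1.1.1 + (p n).1.1.2) 0 i -
    (a ((p n).1.2 * 0 + (p n).2) *m (p n).1.1.1) 0 i).
    by apply/funext => n; rewrite [in RHS]mxE addrC addKr.
  by rewrite /x 2!mxE; apply: cvgB; [exact: img|exact: ahA].
exists (fun y => y *m A + x), (fun t => e * t + s); split.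
- exists A, x; split=> //.
  + apply/matrixP => i j.
    have AAT : (fun n => ((p n).1.1.1 *m (p n).1.1.1^T) i j) @ F --> (A *m A^T) i j.
      apply: cvg_mulmx_coord => // i' j'; rewrite mxE.
      by under eq_fun do rewrite mxE; exact: pA.
    have AA1 : (fun n => ((p n).1.1.1 *m (p n).1.1.1^T) i j) @ F -->
        (1%:M : 'M[R]_3) i j.
      have -> : (fun n => ((p n).1.1.1 *m (p n).1.1.1^T) i j) =
          (fun=> (1%:M : 'M[R]_3) i j).
        by apply/funext => n; case: (pP n) => ->.
      exact: cvg_cst.
    exact: (cvg_unique _ AAT AA1).
  + have dA : (fun n => \det (p n).1.1.1) @ F --> \det A by exact: cvg_det.
    have d1 : (fun n => \det (p n).1.1.1) @ F --> (1 : R).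
      have -> : (fun n => \det (p n).1.1.1) = (fun=> 1).
        by apply/funext => n; case: (pP n).
      exact: cvg_cst.
    exact: (cvg_unique _ dA d1).
- exists e, s; split=> //.
  have /eqP : e ^+ 2 = 1.
    have e2 : (fun n => (p n).1.2 ^+ 2) @ F --> e ^+ 2.
      by rewrite expr2; under eq_fun do rewrite expr2; exact: cvgM.
    have e1 : (fun n => (p n).1.2 ^+ 2) @ F --> (1 : R).
      have -> : (fun n => (p n).1.2 ^+ 2) = (fun=> 1).
        by apply/funext => n; case: (pP n).
      exact: cvg_cst.
    exact: (cvg_unique _ e2 e1).
  by rewrite sqrf_eq1 => /orP[] /eqP ->; [left|right].
- apply/funext => t; apply/rowP => i /=.
  have lim : (fun n => (a ((p n).1.2 * t + (p n).2) *m (p n).1.1.1 +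
      (p n).1.1.2) 0 i) @ F --> (a (e * t + s) *m A + x) 0 i.
    rewrite [X in _ --> X]mxE; under eq_fun do rewrite mxE.
    by apply: cvgD; [exact: ahA|exact: px].
  exact: (cvg_unique _ (img t i) lim).
Qed.

End Isometries.

(** * The quotient space of shapes *)

Section Topology.
Variable R : realType.
Implicit Types (f h : R -> 'E3[R]) (e : R).

Lemma uniform_nbhs_enorm (f : {uniform R -> 'E3[R]})
    (P : set {uniform R -> 'E3[R]}) :
  nbhs f P <-> exists2 e, 0 < e &
    forall h : R -> 'E3[R], (forall t, enorm (h t - f t) <= e) -> P h.
Proof.
split=> [/uniform_nbhs[E [entE EP]]|[e e0 eP]].
  move: entE; rewrite -entourage_ballE => -[e /= e0 eE].
  exists (e / 2); first by rewrite divr_gt0.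
  move=> h he; apply: EP => t _; apply: eE => /=.
  rewrite -ball_normE/= distrC (le_lt_trans (normr_le_enorm _))//.
  by rewrite (le_lt_trans (he t))// ltr_pdivrMr// ltr_pMr// ltr1n.
apply/uniform_nbhs; exists [set xy | ball xy.1 (e / 2) xy.2]; split.
  by rewrite -entourage_ballE; exists (e / 2) => //=; rewrite divr_gt0.
move=> h /= he; apply: eP => t; have := he t I.
rewrite -ball_normE/= => fh; rewrite enormBC (le_trans (enorm_le_normr _))//.
by rewrite mulrC -ler_pdivlMr// ltW.
Qed.

Variables (K : set (set 'E3[R])) (Lam : R).

Lemma config_nbhs (c : config K Lam) (A : set (config K Lam)) : nbhs c A ->
  exists2 e, 0 < e & forall d : config K Lam,
    (forall t, enorm (val d t - val c t) <= e) ->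
    (forall t, enorm (derive1 (val d) t - derive1 (val c) t) <= e) -> A d.
Proof.
rewrite nbhsE => -[_ [[B oB <-] Bc] BA].
have : nbhs (C1_jet c) B by exact: open_nbhs_nbhs.
move=> [[P Q] /= [/uniform_nbhs_enorm[e e0 eP] /uniform_nbhs_enorm[e' e'0 eQ]] PQ].
exists (Num.min e e'); first by rewrite lt_min e0.
move=> d dc d'c; apply/BA/(PQ (C1_jet d)); split; [apply: eP|apply: eQ] => t /=.
  by rewrite (le_trans (dc t))// ge_min lexx.
by rewrite (le_trans (d'c t))// ge_min lexx orbT.
Qed.

Lemma config_uniform_nbhs (c : config K Lam) e : 0 < e ->
  nbhs c [set d : config K Lam | forall t, enorm (val d t - val c t) <= e].
Proof.
move=> e0; have Pc : nbhs (C1_jet c).1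
    [set h : {uniform R -> 'E3[R]} | forall t, enorm (h t - val c t) <= e].
  by apply/uniform_nbhs_enorm; exists e.
have jc : {for c, continuous (fst \o @C1_jet R K Lam)}.
  apply: continuous_comp; first exact: (@initial_continuous _ _ (@C1_jet R K Lam)).
  exact: cvg_fst.
exact: jc Pc.
Qed.

(** This is the open ball for the uniform distance modulo isometries and reparametrisations;
    [e' < e] expresses a strict bound without a supremum. Velocities are left out, since uniform
    distance already separates shapes. *)
Definition shape_ball (c : config K Lam) e : set (config K Lam) :=
  [set d | exists2 g, same_shape (val d) g &
    exists2 e', e' < e & forall t, enorm (g t - val c t) <= e'].

Lemma shape_ball_open c e : open (shape_ball c e).
Proof.
rewrite openE => d [g [f [h [fI hI ->]]] [e' e'e ge']].
have e2 : 0 < (e - e') / 2 by rewrite divr_gt0// subr_gt0.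
apply: filterS (config_uniform_nbhs d e2) => d' /= d'd.
exists (f \o val d' \o h); first by exists f, h.
exists (e' + (e - e') / 2); first by lra.
move=> t; have := ler_enormB (f (val d' (h t))) (f (val d (h t))) (val c t).
have := d'd (h t); rewrite -(proper_isometry_enorm _ _ fI).
by have := ge' t; rewrite /=; lra.
Qed.

Lemma shape_ball_saturated c e (d d' : config K Lam) :
  same_shape (val d) (val d') -> shape_ball c e d -> shape_ball c e d'.
Proof.
move=> dd' [g dg gc]; exists g => //.
exact: same_shape_trans (same_shape_sym dd') dg.
Qed.

Lemma rope_eqP (c d : config K Lam) :
  \pi_(rope_space K Lam)%qT c = \pi_(rope_space K Lam)%qT d <->
  same_shape (val c) (val d).
Proof.
split=> [/eqmodP/asboolP//|cd]; apply/eqmodP; exact/asboolP.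
Qed.

Lemma rope_space_hausdorff : hausdorff_space (rope_space K Lam).
Proof.
rewrite open_hausdorff => x y xy.
pose c := repr x; pose d := repr y.
have ncd : ~ same_shape (val c) (val d).
  by move/rope_eqP; rewrite !reprK => E; rewrite E eqxx in xy.
(* If the balls met for every radius, copies of [c] would come arbitrarily close to [d], and
   closedness would make the two shapes equal. *)
have [e e0 disj] : exists2 e, 0 < e &
    forall b, shape_ball c e b -> ~ shape_ball d e b.
  apply: contrapT => no; apply: ncd.
  have [s [svc _ _ _]] := configuration_knot (set_valP c).
  have [ci _ _ _ _] := svc.
  apply: same_shape_closed; first exact: continuous_knot svc.
    by move=> r t; exact: circle_injection_eq ci.
  move=> e e0; have e2 : 0 < e / 2 by rewrite divr_gt0.
  have [b bc bd] : exists2 b, shape_ball c (e / 2) b & shape_ball d (e / 2) b.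
    apply: contrapT => nb; apply: no; exists (e / 2) => // b bc bd.
    by apply: nb; exists b.
  have [g1 bg1 [e1 e1e g1c]] := bc; have [g2 bg2 [e3 e3e g2d]] := bd.
  have [f [h [fI hI g2E]]] := same_shape_trans (same_shape_sym bg1) bg2.
  exists (f \o val c \o h); first by exists f, h.
  move=> t; rewrite (le_trans (ler_enormB _ (g2 t) _))//.
  have -> : enorm ((f \o val c \o h) t - g2 t) = enorm (g1 (h t) - val c (h t)).
    by rewrite g2E /= (proper_isometry_enorm _ _ fI) enormBC.
  have := g2d t; have := g1c (h t); lra.
pose W a : set (rope_space K Lam) := [set q | shape_ball a e (repr q)].
have piW a : \pi_(rope_space K Lam)%qT @^-1` W a = shape_ball a e.
  apply/seteqP; split=> b; apply: shape_ball_saturated; apply/rope_eqP;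
    by rewrite reprK.
have oW a : open (W a).
  by rewrite /open/= /quotient_open piW; exact: shape_ball_open.
have selfW a : shape_ball a e a.
  exists (val a); first exact: same_shape_refl.
  by exists 0 => // t; rewrite subrr enorm0.
exists (W c, W d) => /=; first by rewrite !inE; split; exact: selfW.
split=> //; apply/eqP/seteqP; split=> // q [qc qd].
exact: disj qc qd.
Qed.

(** The knot type survives because a translation is a displacement of Lipschitz constant 0. *)
Lemma configuration_translate g b : knot_type K ->
  configuration K Lam g -> configuration K Lam (fun t => g t - b).
Proof.
move=> [k tk ->] /configuration_knot[c [gvc tb Kg len]].
have [gi gv vc c0 cE] := gvc.
apply: (@knot_configuration _ _ _ _ (derive1 g) c) => //.
- split=> //.
    move=> s t; split=> [/addIr/gi//|st].
    by rewrite (circle_injection_eq gi st).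
  move=> t; have := is_deriveB (gv t) (is_derive_cst b t 1); rewrite subr0.
  exact.
- move=> s t /=; have -> : g t - b - (g s - b) = g t - g s.
    by apply/rowP => i; rewrite !mxE; ring.
  exact: tb.
- apply: ambient_isotopic_trans Kg _.
  have -> : range (fun t => g t - b) = (fun x => x + (fun=> - b) x) @` range g.
    by rewrite image_comp.
  apply: perturbation_isotopic => x y.
  by rewrite subrr normr0 mulr_ge0 ?invr_ge0.
Qed.

Lemma rope_space_compact : knot_type K -> compact [set: rope_space K Lam].
Proof.
move=> KT; have pi_gt0 := pi_gt0 R.
rewrite compact_ultra => G UG _.
have PG : ProperFilter G by exact: ultra_proper.
have FG : Filter G by exact: filter_filter.
pose g (q : rope_space K Lam) t := val (repr q) t - val (repr q) 0.
have gK q : configuration K Lam (g q).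
  by apply: configuration_translate => //; exact: set_valP.
have /choice[c gc] q := configuration_knot (gK q).
have gvc q : constant_speed_knot (g q) (derive1 (g q)) (c q) by case: (gc q).
have tb q : tangent_balls (g q) (derive1 (g q)) (c q) by case: (gc q).
have g0 q : g q 0 = 0 by rewrite /g subrr.
have cM q : c q <= Lam / (2 * pi).
  by rewrite ler_pdivlMr ?pi2_gt0// mulrC; case: (gc q).
have [g' [v' [c' [g'v'c' tb' c'M gg' vv']]]] := ultra_limit_knot UG gvc tb g0 cM.
have [gi' gv' _ _ _] := g'v'c'.
pose M := Lam / (2 * pi).
have M0 : 0 <= M by rewrite (le_trans _ c'M)//; case: g'v'c' => _ _ _ /ltW.
have unif_g := @ultra_uniform _ _ _ UG g g' M.
have unif_v := @ultra_uniform _ _ _ UG (fun q => derive1 (g q)) v' (2 * M ^+ 2).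
have c2M a : 0 <= a <= M -> 2 * a ^+ 2 <= 2 * M ^+ 2.
  by move=> /andP[a0 aM]; rewrite ler_pM2l// ler_sqr.
have cq_bd q : 0 <= c q <= M by rewrite cM andbT; case: (gvc q) => _ _ _ /ltW.
have c'_bd : 0 <= c' <= M by rewrite c'M andbT; case: g'v'c' => _ _ _ /ltW.
have {}unif_g e : 0 < e -> \forall q \near G, forall t, enorm (g q t - g' t) <= e.
  apply: unif_g => //.
  - by move=> q s t; rewrite (le_trans (knot_lipschitz (gvc q) _ _))// ler_wpM2r.
  - by move=> s t; rewrite (le_trans (knot_lipschitz g'v'c' _ _))// ler_wpM2r.
  - by move=> q s t; case: (gvc q) => gi _ _ _ _; exact: circle_injection_eq gi.
  - by move=> s t; exact: circle_injection_eq gi'.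
have {}unif_v e : 0 < e -> \forall q \near G, forall t,
    enorm (derive1 (g q) t - v' t) <= e.
  apply: unif_v => //.
  - move=> q s t.
    by rewrite (le_trans (velocity_lipschitz (gvc q) (tb q) _ _))// ler_wpM2r// c2M.
  - move=> s t.
    by rewrite (le_trans (velocity_lipschitz g'v'c' tb' _ _))// ler_wpM2r// c2M.
  - move=> q s t; case: (gvc q) => gi gv _ _ _; exact: derive_circle_eq gi gv.
  - by move=> s t; exact: derive_circle_eq gi' gv'.
have Kg' : K (range g').
  have pi32 : 0 < (32 * pi)^-1 :> R by rewrite invr_gt0 mulr_gt0.
  (* A single curve whose velocity is uniformly within 1/(32 pi) of [v'] hands its knot type to the
     limit. *)
  have [q qv] := filter_ex (unif_v _ pi32).
  have [_ _ Kq _] := gc q; case: KT Kq => k _ -> Kq.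
  apply: ambient_isotopic_trans Kq _.
  apply: C1_close_isotopic (gvc q) (tb q) gi' gv' _ => t.
  rewrite -ler_pdivlMl ?mulr_gt0// mulr1 enormBC; exact: qv.
have g'K : configuration K Lam g'.
  apply: (knot_configuration g'v'c' tb' Kg').
  by rewrite mulrC -ler_pdivlMr ?pi2_gt0.
pose N q : config K Lam := exist _ (g q) (mem_set (gK q)).
pose p : config K Lam := exist _ g' (mem_set g'K).
have vE : derive1 g' = v' by apply/funext => t; exact: (derive1_val (gv' t)).
have NG : N @ G --> p.
  move=> A /config_nbhs[e e0 eA].
  apply: filterS (filterI (unif_g _ e0) (unif_v _ e0)) => q [qg qv].
  by apply: eA => t //=; rewrite vE.
(* [N q] is a translate of the chosen representative, so [N] is a section of the quotient map and
   convergence of [N] along [G] projects to convergence of [G]. *)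
exists (\pi_(rope_space K Lam)%qT p); split=> // A.
move=> /pi_continuous/NG NA; apply: (@filterS _ G FG _ _ _ NA) => q.
rewrite /preimage/=; suff -> : \pi_(rope_space K Lam)%qT (N q) = q by [].
rewrite -[RHS]reprK; apply/rope_eqP; apply: same_shape_sym.
exists (fun x => x - val (repr q) 0), id; split=> //.
  exists 1%:M, (- val (repr q) 0); split; rewrite ?trmx1 ?mulmx1 ?det1// => x.
  by rewrite mulmx1.
by exists 1, 0; split; [left|move=> t; rewrite mul1r addr0].
Qed.

End Topology.

Theorem theorem6p5 (R : realType) (K : set (set 'E3[R])) (Lam : R) :
  knot_type K -> (min_ropelength K <= Lam%:E)%E ->
  compact [set: rope_space K Lam] /\ hausdorff_space (rope_space K Lam).
Proof.
by move=> KT _; split; [exact: rope_space_compact|exact: rope_space_hausdorff].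
Qed.
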